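(* Let $(K_f,A_g)$ be a Riemann–Roch pair on a lattice $\Lambda$. The $\lambda$-operator induces on $K_f$ the structure of a $\lambda$-ring. Furthermore, $\lambda$ extends multiplicatively to $\mathbb{Q}K_f$, also making it a $\lambda$-ring.
   Context: A lattice $\Lambda$ is a free abelian group of finite rank; $P(\Lambda)$ is the ring of polynomial functions $\Lambda\to\mathbb{Q}$ with rational coefficients. $\mathrm{Sh}(\Lambda)=\mathbb{Z}[\Lambda]$ is the group ring with basis $T^u$, acting on functions by $(T^uh)(x)=h(x+u)$. $\mathrm{Diff}(\Lambda)$ is the ring of differential operators with constant integer coefficients acting on $P(\Lambda)$. $\mathbb{Q}R=\mathbb{Q}\otimes_{\mathbb{Z}}R$. $K_f=\mathrm{Sh}(\Lambda)/\mathrm{Ann}(f)$, $A_g=\mathrm{Diff}(\Lambda)/\mathrm{Ann}(g)$ ($\mathrm{Ann}$: ideal of operators killing the polynomial). $(K_f,A_g)$ is a Riemann–Roch pair if $f,g\in P(\Lambda)$, $g$ is homogeneous, and $f=\mathrm{td}\cdot g$ for some unit $\mathrm{td}\in(\mathbb{Q}A_g)^\times$ (where $[D]\cdot g:=D\cdot g$). For a Riemann–Roch pair, the $\lambda$-operator is the unique multiplicative map $\lambda\colon K_f\to K_f[[t]]$ (i.e. homomorphism from the additive group of $K_f$ to the group of units of $K_f[[t]]$) with $\lambda([T^u])=1+[T^u]t$ for all $u\in\Lambda$; $\lambda^k(\xi)$ is the coefficient of $t^k$ in $\lambda(\xi)$. The extension to $\mathbb{Q}K_f$ is the multiplicative map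 with $\lambda(a[T^u])=(1+[T^u]t)^a:=\sum_{k\ge0}\binom ak[T^{ku}]t^k$ for $a\in\mathbb{Q}$, $u\in\Lambda$. ''$\lambda$-ring'' is in the sense of Knutson (sometimes called special $\lambda$-ring): $\lambda^0=1$, $\lambda^1=\mathrm{id}$, $\lambda^k(x+y)=\sum_{i+j=k}\lambda^i(x)\lambda^j(y)$, $\lambda(1)=1+t$, and $\lambda^k(xy)$, $\lambda^k(\lambda^l(x))$ are given by the usual universal integer polynomials in the $\lambda^i(x),\lambda^j(y)$, resp. in the $\lambda^i(x)$. *)

(* Defs.v *)
From HB Require Import structures.
From mathcomp Require Import all_boot all_order all_algebra.
From mathcomp Require Import zify.
From mathcomp Require Import ssrcomplements freeg mpoly.
From mathcomp Require Import boolp.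

Set Implicit Arguments.
Unset Strict Implicit.
Unset Printing Implicit Defensive.

Import Order.TTheory GRing.Theory Num.Theory.
Local Open Scope ring_scope.
Local Open Scope quotient_scope.

(* The library's {ideal_quot I} requires I to be proper, but Ann(0) is the
   whole ring; here I may be improper, and quotients may be zero rings. *)

HB.mixin Record isAbsorbing (R : pzRingType) (S : R -> bool) := {
  absorbing_subproof : forall a u, S u -> S (a * u)
}.

#[short(type="idealClosed")]
HB.structure Definition IdealClosed (R : pzRingType) :=
  {S of GRing.ZmodClosed R S & isAbsorbing R S}.

Lemma idealClosedM (R : pzRingType) (I : idealClosed R) (a u : R) :
  u \in I -> a * u \in I.
Proof. exact: (@absorbing_subproof _ I a u). Qed.

Section QuotientRing.
Variables (R : comPzRingType) (I : idealClosed R).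

Definition quot_ring : Type := Quotient.quot I.
HB.instance Definition _ := GRing.Zmodule.on quot_ring.

Definition quot_class (x : R) : quot_ring := \pi_(Quotient.quot I) x.
Definition quot_repr (q : quot_ring) : R := repr (q : Quotient.quot I).

Lemma quot_reprK q : quot_class (quot_repr q) = q.
Proof. exact: reprK. Qed.

Lemma quot_classP x y : (quot_class x = quot_class y) <-> x - y \in I.
Proof. by rewrite Quotient.idealrBE; split=> [h|/eqP //]; apply/eqP. Qed.

Lemma quot_classB : {morph quot_class : x y / x - y}.
Proof. by move=> x y; rewrite /quot_class raddfB. Qed.

Lemma quot_classD : {morph quot_class : x y / x + y}.
Proof. by move=> x y; rewrite /quot_class raddfD. Qed.

Definition quot_mul (p q : quot_ring) := quot_class (quot_repr p * quot_repr q).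

Lemma quot_mulE x y : quot_mul (quot_class x) (quot_class y) = quot_class (x * y).
Proof.
apply/quot_classP.
have [hx hy] : quot_repr (quot_class x) - x \in I /\
               quot_repr (quot_class y) - y \in I.
  by split; apply/quot_classP; rewrite quot_reprK.
set x' := quot_repr _ in hx *; set y' := quot_repr _ in hy *.
have -> : x' * y' - x * y = x' * (y' - y) + y * (x' - x).
  by rewrite !mulrBr (mulrC y x') (mulrC y x) addrA subrK.
by rewrite rpredD ?idealClosedM.
Qed.

Lemma quot_mulA : associative quot_mul.
Proof.
move=> p q r; rewrite -(quot_reprK p) -(quot_reprK q) -(quot_reprK r).
by rewrite !quot_mulE mulrA.
Qed.

Lemma quot_mulC : commutative quot_mul.
Proof. by move=> p q; rewrite /quot_mul mulrC. Qed.

Lemma quot_mul1 : left_id (quot_class 1) quot_mul.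
Proof. by move=> p; rewrite -(quot_reprK p) quot_mulE mul1r. Qed.

Lemma quot_mulDl : left_distributive quot_mul +%R.
Proof.
move=> p q r; rewrite -(quot_reprK p) -(quot_reprK q) -(quot_reprK r).
by rewrite -quot_classD !quot_mulE mulrDl quot_classD.
Qed.

HB.instance Definition _ := GRing.Zmodule_isComPzRing.Build quot_ring
  quot_mulA quot_mulC quot_mul1 quot_mulDl.

HB.instance Definition _ := GRing.isZmodMorphism.Build R quot_ring quot_class
  quot_classB.

Lemma quot_class_monoid : monoid_morphism quot_class.
Proof. by split=> // x y; rewrite -quot_mulE. Qed.

HB.instance Definition _ := GRing.isMonoidMorphism.Build R quot_ring quot_class
  quot_class_monoid.

End QuotientRing.

(* Q (x)_Z R, built as the fractions r / n with r in R and n a positive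
   integer; tensQ_universal below is its universal property as a tensor
   product over Z. R may have torsion, whence the factor k in fracQ_eqv. *)

Section TensQ.
Variable R : comPzRingType.

(* (r, n) stands for r / (n + 1). *)
Definition fracQ_eqv (x y : R * nat) : bool :=
  `[< exists k : nat, x.1 *+ (y.2.+1 * k.+1) = y.1 *+ (x.2.+1 * k.+1) >].

Lemma fracQ_eqv_refl : reflexive fracQ_eqv.
Proof. by move=> x; apply/asboolP; exists 0%N. Qed.

Lemma fracQ_eqv_sym : ssrbool.symmetric fracQ_eqv.
Proof. by move=> x y; apply/asboolP/asboolP => -[k hk]; exists k. Qed.

Lemma fracQ_eqv_trans : transitive fracQ_eqv.
Proof.
move=> [s n] [r m] [t p] /asboolP[/= k hk] /asboolP[/= l hl]; apply/asboolP => /=.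
exists (n.+1 * k.+1 * l.+1).-1; rewrite prednK //.
have -> : (p.+1 * (n.+1 * k.+1 * l.+1) = n.+1 * k.+1 * (p.+1 * l.+1))%N by lia.
have -> : (m.+1 * (n.+1 * k.+1 * l.+1) = n.+1 * l.+1 * (m.+1 * k.+1))%N by lia.
rewrite mulrnA hk -mulrnA.
have -> : (m.+1 * k.+1 * (p.+1 * l.+1) = p.+1 * l.+1 * (m.+1 * k.+1))%N by lia.
by rewrite mulrnA hl -mulrnA; congr (_ *+ _); lia.
Qed.

Canonical fracQ_equiv :=
  EquivRel fracQ_eqv fracQ_eqv_refl fracQ_eqv_sym fracQ_eqv_trans.

Definition tensQ : Type := {eq_quot fracQ_eqv}.
HB.instance Definition _ := Choice.on tensQ.

Definition fracQ (r : R) (n : nat) : tensQ := \pi_({eq_quot fracQ_eqv}) (r, n).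
Definition numQ (x : tensQ) : R := (repr (x : {eq_quot fracQ_eqv})).1.
Definition denQ (x : tensQ) : nat := (repr (x : {eq_quot fracQ_eqv})).2.

Lemma fracQK x : fracQ (numQ x) (denQ x) = x.
Proof. by rewrite /fracQ /numQ /denQ -surjective_pairing; exact: reprK. Qed.

Lemma fracQP r m s n : fracQ r m = fracQ s n <->
  exists k : nat, r *+ (n.+1 * k.+1) = s *+ (m.+1 * k.+1).
Proof.
split=> [/eqP|h]; first by rewrite eqmodE => /asboolP.
by apply/eqP; rewrite eqmodE; apply/asboolP.
Qed.

Lemma fracQ_eq r m s n : r *+ n.+1 = s *+ m.+1 -> fracQ r m = fracQ s n.
Proof. by move=> h; apply/fracQP; exists 0%N; rewrite !muln1. Qed.

Definition mden (m n : nat) : nat := (m.+1 * n.+1).-1.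

Lemma mdenE m n : (mden m n).+1 = (m.+1 * n.+1)%N.
Proof. by []. Qed.

Lemma mdenC : commutative mden.
Proof. by move=> m n; rewrite /mden mulnC. Qed.

Lemma mdenA : associative mden.
Proof. by move=> m n p; apply: succn_inj; rewrite !mdenE mulnA. Qed.

Lemma mden0 : left_id 0%N mden.
Proof. by move=> m; rewrite /mden mul1n. Qed.

Definition tadd (x y : tensQ) : tensQ :=
  fracQ (numQ x *+ (denQ y).+1 + numQ y *+ (denQ x).+1) (mden (denQ x) (denQ y)).
Definition topp (x : tensQ) : tensQ := fracQ (- numQ x) (denQ x).
Definition tmul (x y : tensQ) : tensQ :=
  fracQ (numQ x * numQ y) (mden (denQ x) (denQ y)).

Lemma taddE r m s n :
  tadd (fracQ r m) (fracQ s n) = fracQ (r *+ n.+1 + s *+ m.+1) (mden m n).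
Proof.
have /fracQP[k] := fracQK (fracQ r m); have /fracQP[l] := fracQK (fracQ s n).
rewrite /tadd; set r' := numQ (fracQ r m); set m' := denQ (fracQ r m).
set s' := numQ (fracQ s n); set n' := denQ (fracQ s n) => hs hr.
apply/fracQP; exists (k.+1 * l.+1).-1.
rewrite !mdenE ?prednK // !mulrnDl -!mulrnA.
congr (_ + _).
  have -> : (n'.+1 * (m.+1 * n.+1 * (k.+1 * l.+1)) =
             m.+1 * k.+1 * (n'.+1 * n.+1 * l.+1))%N by lia.
  by rewrite mulrnA hr -mulrnA; congr (_ *+ _); lia.
have -> : (m'.+1 * (m.+1 * n.+1 * (k.+1 * l.+1)) =
           n.+1 * l.+1 * (m'.+1 * m.+1 * k.+1))%N by lia.
by rewrite mulrnA hs -mulrnA; congr (_ *+ _); lia.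
Qed.

Lemma toppE r m : topp (fracQ r m) = fracQ (- r) m.
Proof.
have /fracQP[k hk] := fracQK (fracQ r m).
by apply/fracQP; exists k; rewrite !mulNrn hk.
Qed.

Lemma tmulE r m s n : tmul (fracQ r m) (fracQ s n) = fracQ (r * s) (mden m n).
Proof.
have /fracQP[k] := fracQK (fracQ r m); have /fracQP[l] := fracQK (fracQ s n).
rewrite /tmul; set r' := numQ (fracQ r m); set m' := denQ (fracQ r m).
set s' := numQ (fracQ s n); set n' := denQ (fracQ s n) => hs hr.
apply/fracQP; exists (k.+1 * l.+1).-1.
rewrite !mdenE ?prednK //.
have -> : (m.+1 * n.+1 * (k.+1 * l.+1) = m.+1 * k.+1 * (n.+1 * l.+1))%N by lia.
have -> : (m'.+1 * n'.+1 * (k.+1 * l.+1) = m'.+1 * k.+1 * (n'.+1 * l.+1))%N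
  by lia.
have mm (x y : R) a b : x * y *+ (a * b) = (x *+ a) * (y *+ b).
  by rewrite mulrnAl mulrnAr -mulrnA mulnC.
by rewrite !mm hr hs.
Qed.

Lemma tensQ_ind (P : tensQ -> Prop) :
  (forall r m, P (fracQ r m)) -> forall x, P x.
Proof. by move=> h x; rewrite -(fracQK x). Qed.

Lemma taddA : associative tadd.
Proof.
elim/tensQ_ind => r m; elim/tensQ_ind => s n; elim/tensQ_ind => t p.
rewrite !taddE mdenA; congr fracQ; rewrite !mdenE !mulrnDl -!mulrnA addrA.
by congr (_ + _ *+ _ + _ *+ _); rewrite mulnC.
Qed.

Lemma taddC : commutative tadd.
Proof.
elim/tensQ_ind => r m; elim/tensQ_ind => s n.
by rewrite !taddE mdenC addrC.
Qed.

Lemma tadd0 : left_id (fracQ 0 0) tadd.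
Proof. by elim/tensQ_ind => r m; rewrite taddE mden0 mul0rn add0r. Qed.

Lemma taddN : left_inverse (fracQ 0 0) topp tadd.
Proof.
elim/tensQ_ind => r m; rewrite toppE taddE; apply: fracQ_eq.
by rewrite mulNrn addNr !mul0rn.
Qed.

HB.instance Definition _ := GRing.isZmodule.Build tensQ taddA taddC tadd0 taddN.

Lemma tmulA : associative tmul.
Proof.
elim/tensQ_ind => r m; elim/tensQ_ind => s n; elim/tensQ_ind => t p.
by rewrite !tmulE mdenA mulrA.
Qed.

Lemma tmulC : commutative tmul.
Proof.
elim/tensQ_ind => r m; elim/tensQ_ind => s n.
by rewrite !tmulE mdenC mulrC.
Qed.

Lemma tmul1 : left_id (fracQ 1 0) tmul.
Proof. by elim/tensQ_ind => r m; rewrite tmulE mden0 mul1r. Qed.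

Lemma tmulDl : left_distributive tmul +%R.
Proof.
elim/tensQ_ind => r m; elim/tensQ_ind => s n; elim/tensQ_ind => t p.
rewrite [X in tmul X]taddE !tmulE [RHS]taddE; apply: fracQ_eq.
rewrite !mdenE mulrDl !mulrnDl !mulrnAl -!mulrnA.
by congr (_ *+ _ + _ *+ _); lia.
Qed.

HB.instance Definition _ := GRing.Zmodule_isComPzRing.Build tensQ
  tmulA tmulC tmul1 tmulDl.

Lemma fracQD r m s n :
  fracQ r m + fracQ s n = fracQ (r *+ n.+1 + s *+ m.+1) (mden m n).
Proof. exact: taddE. Qed.

Lemma fracQM r m s n : fracQ r m * fracQ s n = fracQ (r * s) (mden m n).
Proof. exact: tmulE. Qed.

Definition inQ (r : R) : tensQ := fracQ r 0.

Lemma inQ_zmod_morphism : zmod_morphism inQ.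
Proof.
by move=> r s; rewrite /inQ [X in _ = _ + X]toppE fracQD mulr1n.
Qed.

HB.instance Definition _ := GRing.isZmodMorphism.Build R tensQ inQ
  inQ_zmod_morphism.

Lemma inQ_monoid_morphism : monoid_morphism inQ.
Proof. by split=> // r s; rewrite /inQ fracQM. Qed.

HB.instance Definition _ := GRing.isMonoidMorphism.Build R tensQ inQ
  inQ_monoid_morphism.

Definition ratQ (a : rat) : tensQ := fracQ (numq a)%:~R `|denq a|.-1.

Lemma ratQE (p : int) (n : nat) : ratQ (p%:~R / n.+1%:R) = fracQ p%:~R n.
Proof.
set a := _ / _; rewrite /ratQ; apply: fracQ_eq.
have d0 : (0 < `|denq a|)%N by rewrite absz_gt0 denq_neq0.
have da : (denq a)%:~R != 0 :> rat by rewrite intr_eq0 denq_neq0.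
have na : n.+1%:R != 0 :> rat by rewrite pnatr_eq0.
rewrite prednK // !pmulrn -!mulrzA absz_denq; congr (_%:~R).
apply: (@intr_inj rat); rewrite !intrM -pmulrn.
have /eqP : a = (numq a)%:~R / (denq a)%:~R by rewrite divq_num_den.
by rewrite {1}/a eqr_div // => /eqP <-.
Qed.

Lemma ratP_nat (P : rat -> Prop) :
  (forall (p : int) (n : nat), P (p%:~R / n.+1%:R)) -> forall a, P a.
Proof.
move=> h a; rewrite -(divq_num_den a).
have : 0 < denq a by exact: denq_gt0.
by case: (denq a) => [[//|n]|//] _; exact: h.
Qed.

Lemma ratQD : {morph ratQ : a b / a + b}.
Proof.
elim/ratP_nat => p m; elim/ratP_nat => q n.
have -> : p%:~R / m.+1%:R + q%:~R / n.+1%:R =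
    (p * n.+1%:Z + q * m.+1%:Z)%:~R / (mden m n).+1%:R :> rat.
  rewrite addf_div ?pnatr_eq0 // mdenE natrM intrD !intrM.
  by rewrite -!pmulrn.
rewrite !ratQE fracQD; congr fracQ.
by rewrite intrD !intrM -!pmulrn !mulr_natr.
Qed.

Lemma ratQM : {morph ratQ : a b / a * b}.
Proof.
elim/ratP_nat => p m; elim/ratP_nat => q n.
have -> : p%:~R / m.+1%:R * (q%:~R / n.+1%:R) =
    (p * q)%:~R / (mden m n).+1%:R :> rat.
  by rewrite mulf_div mdenE natrM intrM.
by rewrite !ratQE fracQM intrM.
Qed.

Lemma ratQ1 : ratQ 1 = 1.
Proof. by have := ratQE 1 0; rewrite divr1. Qed.

Definition scaleQ (a : rat) (x : tensQ) : tensQ := ratQ a * x.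

Lemma scaleQA a b x : scaleQ a (scaleQ b x) = scaleQ (a * b) x.
Proof. by rewrite /scaleQ ratQM mulrA. Qed.

Lemma scaleQ1 : left_id 1 scaleQ.
Proof. by move=> x; rewrite /scaleQ ratQ1 mul1r. Qed.

Lemma scaleQDr : right_distributive scaleQ +%R.
Proof. by move=> a x y; rewrite /scaleQ mulrDr. Qed.

Lemma scaleQDl x : {morph scaleQ^~ x : a b / a + b}.
Proof. by move=> a b; rewrite /scaleQ ratQD mulrDl. Qed.

HB.instance Definition _ := GRing.Zmodule_isLmodule.Build rat tensQ
  scaleQA scaleQ1 scaleQDr scaleQDl.

Lemma scale_fracQ (p : int) n r m :
  (p%:~R / n.+1%:R : rat) *: fracQ r m = fracQ (r *~ p) (mden n m).
Proof. by rewrite /GRing.scale /= /scaleQ ratQE fracQM mulrzl. Qed.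

End TensQ.

Lemma tensQ_universal (R : comPzRingType) (M : zmodType) (b : rat -> R -> M) :
    (forall a, {morph b a : r s / r + s}) ->
    (forall r, {morph b^~ r : x y / x + y}) ->
  exists! h : tensQ R -> M,
    {morph h : x y / x + y} /\ forall a r, h (a *: inQ r) = b a r.
Proof.
move=> bDr bDl.
have b0r a : b a 0 = 0 by apply: (addrI (b a 0)); rewrite -bDr !addr0.
have bMr a r n : b a (r *+ n) = b a r *+ n.
  by elim: n => [|n IH]; rewrite ?mulr0n // !mulrS bDr IH.
have b0l r : b 0 r = 0 by apply: (addrI (b 0 r)); rewrite -bDl !addr0.
have bMl a r n : b (a *+ n) r = b a r *+ n.
  by elim: n => [|n IH]; rewrite ?mulr0n // !mulrS bDl IH.
have bNl a r : b (- a) r = - b a r.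
  by apply: (addrI (b a r)); rewrite -bDl !subrr.
have bNr a r : b a (- r) = - b a r.
  by apply: (addrI (b a r)); rewrite -bDr !subrr.
pose h (x : tensQ R) := b (denQ x).+1%:R^-1 (numQ x).
have bq (m k : nat) r : b m.+1%:R^-1 r = b (m.+1 * k.+1)%:R^-1 (r *+ k.+1).
  rewrite bMr -bMl; congr (b _ r).
  by rewrite -[RHS]mulr_natr natrM invfM mulfVK // pnatr_eq0.
have hE r m : h (fracQ r m) = b m.+1%:R^-1 r.
  have /fracQP[k] := fracQK (fracQ r m); rewrite /h.
  set r' := numQ _; set m' := denQ _ => hk.
  rewrite (bq m' (m.+1 * k.+1).-1) (bq m (m'.+1 * k.+1).-1).
  by rewrite !prednK // hk; congr (b _^-1 _); congr (_%:R); lia.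
have hE' a r : h (a *: inQ r) = b a r.
  elim/ratP_nat: a => p n.
  rewrite scale_fracQ hE mdenE muln1.
  case: p => p.
    by rewrite bMr -bMl; congr (b _ r); rewrite -pmulrn mulr_natl.
  rewrite NegzE mulrNz bNr bMr -bMl -bNl; congr (b _ r).
  by rewrite mulrNz mulNr -pmulrn mulr_natl.
exists h; split; first split=> //.
  elim/tensQ_ind => r m; elim/tensQ_ind => s n.
  by rewrite fracQD !hE mdenE bDr (bq m n) (bq n m) [in RHS](mulnC n.+1).
move=> h' [h'D h'E]; apply: funext; elim/tensQ_ind => r m.
suff -> : fracQ r m = (m.+1%:R^-1 : rat) *: inQ r by rewrite h'E hE'.
by have := scale_fracQ 1 m r 0; rewrite mul1r mulr1z /mden muln1 => ->.
Qed.

(* The structure records an isomorphism with Z^rank, i.e. a Z-basis; the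
   notions below do not depend on its choice. *)

HB.mixin Record isZLattice L of GRing.Zmodule L := {
  rank : nat;
  coord : L -> 'rV[int]_rank;
  coord_zmod_morphism : zmod_morphism coord;
  coord_bij : bijective coord
}.

#[short(type="zlatticeType")]
HB.structure Definition ZLattice := {L of GRing.Zmodule L & isZLattice L}.

Arguments rank L : clear implicits, rename.

HB.instance Definition _ (L : zlatticeType) := GRing.isZmodMorphism.Build
  L 'rV[int]_(rank L) (@coord L) (@coord_zmod_morphism L).

Fact row_coord_zmod_morphism n : zmod_morphism (@id 'rV[int]_n).
Proof. by []. Qed.

HB.instance Definition _ n := isZLattice.Build 'rV[int]_n
  (@row_coord_zmod_morphism n) (inv_bij (fun=> erefl)).

(* The group ring Z[L], with << u >> as T^u. The monoid algebras of monalg.v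
   exclude nontrivial invertible monomials, hence groups. *)

Section GroupRing.
Variable L : zmodType.

Definition Sh : Type := {freeg L / int}.
HB.instance Definition _ := GRing.Lmodule.on Sh.

Definition shT (u : L) : Sh := << u >>.

Definition sh_mul (a b : Sh) : Sh :=
  fglift (fun u => fglift (fun v => shT (u + v)) b) a.

Lemma sh_ind (P : Sh -> Prop) :
    P 0 -> (forall u, P (shT u)) -> (forall a b, P a -> P b -> P (a - b)) ->
  forall a, P a.
Proof.
move=> P0 PT PB a; rewrite -[a]freeg_sumE.
have PN b : P b -> P (- b) by move=> hb; rewrite -sub0r; apply: PB.
have PD b c : P b -> P c -> P (b + c).
  by move=> hb hc; rewrite -[c]opprK; apply: PB => //; apply: PN.
have PM b k : P b -> P (b *+ k).
  by move=> hb; elim: k => [|k IH]; rewrite ?mulr0n ?mulrS //; apply: PD.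
apply: (big_ind P) => // u _; have -> : << coeff u a *g u >> = shT u *~ coeff u a.
  by rewrite /shT freegU_mulz intz.
case: (coeff u a) => k; first exact: PM.
by rewrite NegzE mulrNz; apply/PN/PM.
Qed.

Lemma fglift_zmod (M : lmodType int) (F : L -> M) : zmod_morphism (fglift F).
Proof. exact: lift_is_additive. Qed.

HB.instance Definition _ (M : lmodType int) (F : L -> M) :=
  GRing.isZmodMorphism.Build {freeg L / int} M (fglift F) (fglift_zmod F).

Lemma fglift0 (M : lmodType int) (F : L -> M) : fglift F 0 = 0.
Proof. by rewrite -{1}(subrr (0 : Sh)) fglift_zmod subrr. Qed.

Lemma fgliftT (M : lmodType int) (F : L -> M) u : fglift F (shT u) = F u.
Proof. by rewrite /shT liftU scale1r. Qed.

Lemma sh_mulT u v : sh_mul (shT u) (shT v) = shT (u + v).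
Proof. by rewrite /sh_mul !fgliftT. Qed.

Lemma sh_mulBl a b c : sh_mul (a - b) c = sh_mul a c - sh_mul b c.
Proof. exact: fglift_zmod. Qed.

Lemma sh_mul0l c : sh_mul 0 c = 0.
Proof. exact: fglift0. Qed.

Lemma sh_mulBr a b c : sh_mul c (a - b) = sh_mul c a - sh_mul c b.
Proof.
elim/sh_ind: c => [|u|c d hc hd]; first by rewrite !sh_mul0l subrr.
  by rewrite /sh_mul !fgliftT fglift_zmod.
rewrite !sh_mulBl hc hd !opprB -!addrA; congr (_ + _).
by rewrite addrC addrAC [RHS]addrC -addrA.
Qed.

Lemma sh_mul0r c : sh_mul c 0 = 0.
Proof. by rewrite -{1}(subrr (0 : Sh)) sh_mulBr subrr. Qed.

Lemma sh_mulC : commutative sh_mul.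
Proof.
elim/sh_ind => [|u|a b ha hb] c; first by rewrite sh_mul0l sh_mul0r.
  elim/sh_ind: c => [|v|c d hc hd]; first by rewrite sh_mul0l sh_mul0r.
    by rewrite !sh_mulT addrC.
  by rewrite sh_mulBl sh_mulBr hc hd.
by rewrite sh_mulBl sh_mulBr ha hb.
Qed.

Lemma sh_mulA : associative sh_mul.
Proof.
elim/sh_ind => [|u|a b ha hb] c d; first by rewrite !sh_mul0l.
  elim/sh_ind: c => [|v|c e hc he]; first by rewrite !(sh_mul0l, sh_mul0r).
    elim/sh_ind: d => [|w|d e hd he]; first by rewrite !sh_mul0r.
      by rewrite !sh_mulT addrA.
    by rewrite !sh_mulBr hd he.
  by rewrite !(sh_mulBl, sh_mulBr) hc he.
by rewrite !sh_mulBl ha hb.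
Qed.

Lemma sh_mul1 : left_id (shT 0) sh_mul.
Proof.
elim/sh_ind => [|u|a b ha hb]; first by rewrite sh_mul0r.
  by rewrite sh_mulT add0r.
by rewrite sh_mulBr ha hb.
Qed.

Lemma sh_mulDl : left_distributive sh_mul +%R.
Proof.
move=> a b c; rewrite -{1}[b]opprK sh_mulBl.
by rewrite -(sub0r b) sh_mulBl sh_mul0l sub0r opprK.
Qed.

HB.instance Definition _ := GRing.Zmodule_isComPzRing.Build Sh
  sh_mulA sh_mulC sh_mul1 sh_mulDl.

Lemma shT0 : shT 0 = 1. Proof. by []. Qed.

Lemma shTD u v : shT (u + v) = shT u * shT v.
Proof. exact/esym/sh_mulT. Qed.

(* (T^u h)(x) = h (x + u), extended linearly. *)
Definition sh_act (S : Sh) (h : L -> rat) (x : L) : rat :=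
  \sum_(u <- dom S) h (x + u) *~ coeff u S.

Lemma sh_actE S h x : sh_act S h x = fglift (fun u => h (x + u) : zmodule rat) S.
Proof.
rewrite -{2}[S]freeg_sumE raddf_sum.
by apply: eq_bigr => u _; rewrite /= liftU.
Qed.

Lemma sh_actT u h x : sh_act (shT u) h x = h (x + u).
Proof. by rewrite sh_actE fgliftT. Qed.

Lemma sh_actB S1 S2 h x : sh_act (S1 - S2) h x = sh_act S1 h x - sh_act S2 h x.
Proof. by rewrite !sh_actE fglift_zmod. Qed.

Lemma sh_act0 h x : sh_act 0 h x = 0.
Proof. by rewrite sh_actE fglift0. Qed.

Lemma sh_actM S1 S2 h x : sh_act (S1 * S2) h x = sh_act S1 (sh_act S2 h) x.
Proof.
elim/sh_ind: S1 => [|u|S1 S1' h1 h2]; first by rewrite mul0r !sh_act0.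
  rewrite sh_actT; elim/sh_ind: S2 => [|v|S2 S2' h1 h2].
  - by rewrite mulr0 !sh_act0.
  - by rewrite -shTD !sh_actT addrA.
  - by rewrite mulrBr !sh_actB h1 h2.
by rewrite mulrBl !sh_actB h1 h2.
Qed.

Definition sh_ann (h : L -> rat) : {pred Sh} := fun S =>
  `[< forall x, sh_act S h x = 0 >].

Lemma sh_ann_zmod_closed h : zmod_closed (sh_ann h).
Proof.
split=> [|S1 S2 /asboolP h1 /asboolP h2]; apply/asboolP => x.
  by rewrite sh_act0.
by rewrite sh_actB h1 h2 subrr.
Qed.

HB.instance Definition _ h := GRing.isZmodClosed.Build Sh (sh_ann h)
  (sh_ann_zmod_closed h).

Lemma sh_ann_absorbing h S1 S2 : sh_ann h S2 -> sh_ann h (S1 * S2).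
Proof.
move=> /asboolP h2; apply/asboolP => x; rewrite sh_actM.
have -> : sh_act S2 h = (fun=> 0) by apply: funext.
rewrite sh_actE; elim/sh_ind: S1 => [|u|a b ha hb].
- by rewrite fglift0.
- by rewrite fgliftT.
- by rewrite fglift_zmod ha hb subrr.
Qed.

HB.instance Definition _ h := isAbsorbing.Build Sh (sh_ann h)
  (@sh_ann_absorbing h).

End GroupRing.

Lemma digits_inj n N (a b : 'I_n -> nat) :
    (forall i, (a i < N)%N) -> (forall i, (b i < N)%N) ->
  (\sum_(i < n) a i * N ^ i = \sum_(i < n) b i * N ^ i)%N -> a =1 b.
Proof.
elim: n a b => [|n IH] a b ha hb; first by move=> _ [].
have E c : (\sum_(i < n.+1) c i * N ^ i =
            (\sum_(i < n) c (fintype.lift ord0 i) * N ^ i) * N + c ord0)%N.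
  rewrite big_ord_recl expn0 muln1 addnC big_distrl; congr (_ + _)%N.
  by apply: eq_bigr => i _; rewrite /= expnSr mulnA.
rewrite !E => h.
have h0 : a ord0 = b ord0.
  by have := congr1 (modn^~ N) h; rewrite !modnMDl !modn_small.
have N0 : (0 < N)%N by apply: leq_ltn_trans (ha ord0).
move: h; rewrite h0 => /addIn /eqP; rewrite eqn_pmul2r // => /eqP h i.
by have [j ->|->] := unliftP ord0 i; [exact: (IH _ _ _ _ h) | exact: h0].
Qed.

Lemma meval_nat_eq0 n (p : {mpoly rat[n]}) :
  (forall c : 'I_n -> nat, p.@[fun i => (c i)%:R] = 0) -> p = 0.
Proof.
move=> h; pose N := msize p.
pose e (m : 'X_{1..n}) := (\sum_(i < n) m i * N ^ i)%N.
pose q : {poly rat} := \sum_(m <- msupp p) p@_m *: 'X^(e m).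
have q0 : q = 0.
  apply: (@roots_geq_poly_eq0 _ _ [seq t%:R | t <- iota 0 (size q)]).
  - apply/allP => _ /mapP[t _ ->]; apply/rootP.
    rewrite -(h (fun i => t ^ N ^ i)%N) /q horner_sum /meval /mmap.
    apply: eq_bigr => m _; rewrite hornerZ hornerXn; congr (_ * _).
    rewrite /mmap1 /e -natrX expn_sum natr_prod; apply: eq_bigr => i _.
    by rewrite -natrX -expnM mulnC.
  - by rewrite map_inj_uniq ?iota_uniq // => x y /eqP; rewrite eqr_nat => /eqP.
  - by rewrite size_map size_iota.
apply/mpolyP => m; rewrite mcoeff0.
have [hm|/memN_msupp_eq0 //] := boolP (m \in msupp p).
have := congr1 (fun r : {poly rat} => r`_(e m)) q0.
rewrite coef0 /q coef_sum (bigD1_seq m) ?msupp_uniq //= coefZ coefXn eqxx mulr1.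
rewrite big_seq_cond big1 ?addr0 // => m' /andP[hm' nm].
rewrite coefZ coefXn; case: eqP => [em|_]; last by rewrite mulr0.
have lt k : k \in msupp p -> forall i, (k i < N)%N.
  move=> hk i; apply: leq_ltn_trans (msize_mdeg_lt hk).
  by rewrite mdegE (bigD1 i) //= leq_addr.
by case/negP: nm; apply/eqP/mnmP => i; rewrite (digits_inj (lt _ hm) (lt _ hm') em).
Qed.

Section PolyDiff.
Variable L : zlatticeType.

(* A polynomial function on L is represented by its polynomial in the
   coordinates of L (faithfully, by peval_inj). Diff is Z[d_1, ..., d_rank],
   the variable 'X_i standing for the i-th partial derivative; since d_u is
   an integer combination of the d_i, this is Z[d_u | u in L]. *)
Definition P : Type := {mpoly rat[rank L]}.
Definition Diff : Type := {mpoly int[rank L]}.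
HB.instance Definition _ := GRing.ComNzRing.on P.
HB.instance Definition _ := GRing.Lmodule.on P.
HB.instance Definition _ := GRing.ComNzRing.on Diff.

Definition peval (p : P) (x : L) : rat := p.@[fun i => (coord x 0 i)%:~R].

Lemma peval_inj p q : peval p =1 peval q -> p = q.
Proof.
move=> h; apply/eqP; rewrite -subr_eq0; apply/eqP/meval_nat_eq0 => c.
have [g _ cK] := @coord_bij L.
have := h (g (\row_i (c i)%:Z)); rewrite /peval cK => E.
rewrite mevalB; apply/eqP; rewrite subr_eq0; apply/eqP.
by move: E; congr (_ = _); apply: meval_eq => i; rewrite mxE.
Qed.

Definition diff_act (D : Diff) (p : P) : P :=
  \sum_(m <- msupp D) p^`M[m] *~ D@_m.

Definition diff_ann (g : P) : {pred Diff} := fun D => diff_act D g == 0.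

Lemma diff_actE k D p : (msize D <= k)%N ->
  diff_act D p = \sum_(m : 'X_{1..(rank L) < k}) p^`M[m] *~ D@_m.
Proof.
pose I : subFinType _ := 'X_{1..(rank L) < k}.
move=> hk; rewrite /diff_act (big_mksub I) /=; first last.
- by move=> m /msize_mdeg_lt/leq_trans/(_ hk).
- exact: msupp_uniq.
rewrite big_rmcond //= => m /memN_msupp_eq0 ->.
by rewrite mulr0z.
Qed.

Lemma diff_actB D1 D2 p : diff_act (D1 - D2) p = diff_act D1 p - diff_act D2 p.
Proof.
pose k := maxn (msize (D1 - D2)) (maxn (msize D1) (msize D2)).
rewrite !(@diff_actE k) ?leq_max ?leqnn ?orbT //.
rewrite -sumrB; apply: eq_bigr => m _.
by rewrite mcoeffB mulrzBr.
Qed.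

Lemma diff_act0 p : diff_act 0 p = 0.
Proof. by rewrite /diff_act msupp0 big_nil. Qed.

Lemma diff_actD D1 D2 p : diff_act (D1 + D2) p = diff_act D1 p + diff_act D2 p.
Proof.
rewrite -{1}[D2]opprK diff_actB -[- D2]sub0r diff_actB diff_act0.
by rewrite sub0r opprK.
Qed.

Lemma diff_actX m p : diff_act 'X_[m] p = p^`M[m].
Proof. by rewrite /diff_act msuppX big_seq1 mcoeffX eqxx. Qed.

Lemma diff_act_linear D : linear (diff_act D).
Proof.
move=> c p q; rewrite /diff_act scaler_sumr -big_split; apply: eq_bigr => m _.
by rewrite /= linearP mulrzDl scalerMzr.
Qed.

HB.instance Definition _ D := GRing.isLinear.Build rat P P _ (diff_act D)
  (diff_act_linear D).

Lemma diff_ind (Q : Diff -> Prop) :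
    Q 0 -> (forall m, Q 'X_[m]) -> (forall a b, Q a -> Q b -> Q (a - b)) ->
  forall a, Q a.
Proof.
move=> Q0 QX QB a; rewrite [a]mpolyE.
have QN b : Q b -> Q (- b) by move=> hb; rewrite -sub0r; apply: QB.
have QD b c : Q b -> Q c -> Q (b + c).
  by move=> hb hc; rewrite -[c]opprK; apply: QB => //; apply: QN.
have QM b k : Q b -> Q (b *+ k).
  by move=> hb; elim: k => [|k IH]; rewrite ?mulr0n ?mulrS //; apply: QD.
apply: (big_ind Q) => // m _; rewrite -[a@_m]intz scaler_int.
case: (a@_m) => k; first exact: QM.
by rewrite NegzE mulrNz; apply/QN/QM.
Qed.

Lemma diff_actM D1 D2 p : diff_act (D1 * D2) p = diff_act D1 (diff_act D2 p).
Proof.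
elim/diff_ind: D1 => [|m|a b ha hb]; first by rewrite mul0r !diff_act0.
  elim/diff_ind: D2 => [|l|a b ha hb].
  - by rewrite mulr0 diff_act0 linear0.
  - by rewrite -mpolyXD !diff_actX addmC mderivmDm.
  - by rewrite mulrBr !diff_actB linearB ha hb.
by rewrite mulrBl !diff_actB ha hb.
Qed.

Lemma diff_ann_zmod_closed g : zmod_closed (diff_ann g).
Proof.
split=> [|D1 D2 /eqP h1 /eqP h2]; apply/eqP; first exact: diff_act0.
by rewrite diff_actB h1 h2 subrr.
Qed.

HB.instance Definition _ g := GRing.isZmodClosed.Build Diff (diff_ann g)
  (diff_ann_zmod_closed g).

Lemma diff_ann_absorbing g D1 D2 : diff_ann g D2 -> diff_ann g (D1 * D2).
Proof. by move=> /eqP h2; apply/eqP; rewrite diff_actM h2 linear0. Qed.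

HB.instance Definition _ g := isAbsorbing.Build Diff (diff_ann g)
  (@diff_ann_absorbing g).

End PolyDiff.

Arguments P L : clear implicits.

Section RiemannRoch.
Variable L : zlatticeType.

Definition K (f : P L) : comPzRingType := quot_ring (sh_ann (peval f)).
Definition A (g : P L) : comPzRingType := quot_ring (diff_ann g).

Definition KT (f : P L) (u : L) : K f := quot_class _ (shT u).

(* The action of Q (x) A_g on g: [D] / (n + 1) sends g to (D . g) / (n + 1). *)
Definition AQ_act (g : P L) (x : tensQ (A g)) : P L :=
  (denQ x).+1%:R^-1 *: diff_act (quot_repr (numQ x)) g.

Lemma AQ_actE g (D : Diff L) n :
  AQ_act (fracQ (quot_class _ D : A g) n) = n.+1%:R^-1 *: diff_act D g.
Proof.
have actMn D' k : diff_act (D' *+ k) g = diff_act D' g *+ k.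
  elim: k => [|k IH]; first by rewrite !mulr0n diff_act0.
  by rewrite !mulrSr diff_actD IH.
set x := fracQ _ n; have /fracQP[k] := fracQK x; rewrite -/x.
rewrite -[numQ x]quot_reprK -!raddfMn => /quot_classP /eqP.
rewrite /AQ_act diff_actB !actMn => /eqP; rewrite subr_eq0 => /eqP.
set E := diff_act D g; set E' := diff_act _ g; set m := denQ x => h.
have n0 j : j.+1%:R != 0 :> rat by rewrite pnatr_eq0.
apply: (scalerI (n0 k)); rewrite !scalerA.
apply: (scalerI (n0 n)); rewrite !scalerA.
apply: (scalerI (n0 m)); rewrite !scalerA.
have cxy (a b c : rat) : a != 0 -> a * (b * (c / a)) = b * c.
  by move=> a0; rewrite mulrCA (mulrC a) divfK.
rewrite cxy // [_ * (n.+1%:R * _)]mulrCA cxy // -!natrM !scaler_nat.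
exact: h.
Qed.

Definition riemann_roch_pair (f g : P L) : Prop :=
  (exists d, g \is d.-homog) /\
  exists td td' : tensQ (A g), td * td' = 1 /\ f = AQ_act td.

End RiemannRoch.

Section PowerSeries.
Variable R : comPzRingType.

(* R[[t]], a power series being its sequence of coefficients. *)
Definition pseries : Type := nat -> R.
Definition ps_one : pseries := fun k => (k == 0)%:R.
Definition ps_lin (x : R) : pseries := fun k => [:: 1; x]`_k.
Definition ps_mul (a b : pseries) : pseries :=
  fun k => \sum_(i < k.+1) a i * b (k - i)%N.

Definition ps_unit (a : pseries) : Prop := exists b, ps_mul a b =1 ps_one.

Definition ps_multiplicative (lam : R -> pseries) : Prop :=
  (forall x, ps_unit (lam x)) /\
  forall x y, lam (x + y) =1 ps_mul (lam x) (lam y).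

End PowerSeries.

Section LambdaRing.

Definition int_eval (R : comPzRingType) n (p : {mpoly int[n]}) (v : 'I_n -> R) : R :=
  \sum_(m <- msupp p) (\prod_(i < n) v i ^+ m i) *~ p@_m.

(* e_1, ..., e_k of the variables x_j = 'X_(lshift k j), followed by those of
   the variables y_j = 'X_(rshift k j). *)
Definition esym2 k (i : 'I_(k + k)) : {mpoly int[k + k]} :=
  match split i with
  | inl a => int_eval (mesym k int a.+1) (fun j => 'X_(lshift k j))
  | inr b => int_eval (mesym k int b.+1) (fun j => 'X_(rshift k j))
  end.

(* P_k(e_1(x), ..., e_k(x), e_1(y), ..., e_k(y)) is the coefficient of t^k in
   the product of the 1 + x_i y_j t. *)
Definition universal_prod k (p : {mpoly int[k + k]}) : Prop :=
  int_eval p (@esym2 k) =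
  (\prod_(i < k) \prod_(j < k)
     (1 + ('X_(lshift k i) * 'X_(rshift k j)) *: 'X) : {poly {mpoly int[k + k]}})`_k.

(* P_{k,l}(e_1(x), ..., e_kl(x)) is the coefficient of t^k in the product of
   the 1 + x_{i_1} ... x_{i_l} t over i_1 < ... < i_l <= kl. *)
Definition universal_comp k l (p : {mpoly int[k * l]}) : Prop :=
  int_eval p (fun i => mesym (k * l) int i.+1) =
  (\prod_(h : {set 'I_(k * l)} | #|h| == l)
     (1 + (\prod_(i in h) 'X_i) *: 'X) : {poly {mpoly int[k * l]}})`_k.

(* The e_i being algebraically independent, the polynomials p in lambdaM and
   lambda_comp are uniquely determined by k and l. *)
Record lambda_ring (R : comPzRingType) (lam : R -> pseries R) : Prop := {
  lambda0 : forall x, lam x 0%N = 1;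
  lambda1 : forall x, lam x 1%N = x;
  lambdaD : forall k x y, lam (x + y) k = \sum_(i < k.+1) lam x i * lam y (k - i)%N;
  lambda_one : lam 1 =1 ps_lin 1;
  lambdaM : forall k, exists2 p : {mpoly int[k + k]}, universal_prod p &
    forall x y, lam (x * y) k =
      int_eval p (fun i => match split i with
                           | inl a => lam x a.+1
                           | inr b => lam y b.+1
                           end);
  lambda_comp : forall k l, exists2 p : {mpoly int[k * l]}, universal_comp p &
    forall x, lam (lam x l) k = int_eval p (fun i => lam x i.+1)
}.

End LambdaRing.

Section LambdaOperator.
Variables (L : zlatticeType) (f : P L).

Definition is_lambda_operator (lam : K f -> pseries (K f)) : Prop :=
  ps_multiplicative lam /\
  forall u : L, lam (KT f u) =1 ps_lin (KT f u).

Definition rat_binomial (a : rat) (k : nat) : rat :=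
  (\prod_(i < k) (a - i%:R)) / k`!%:R.

Definition is_rational_lambda_operator
    (lam : tensQ (K f) -> pseries (tensQ (K f))) : Prop :=
  ps_multiplicative lam /\
  forall (a : rat) (u : L) (k : nat),
    lam (a *: inQ (KT f u)) k = rat_binomial a k *: inQ (KT f (u *+ k)).

End LambdaOperator.

(* Main.v *)
(* Call a power series a with constant term 1 and a sequence p related when
   t a'(t) / a(t) = sum_(i > 0) (-1)^(i-1) p_i t^i, as holds for the elementary
   symmetric functions and the power sums of any family. In a Q-algebra each
   of a and p determines the other. Hence commuting ring endomorphisms psi^i
   with psi^i psi^j = psi^(ij) and psi^1 = id yield a series lam x related to
   (psi^i x)_i, and this is a lambda-structure: the universal identities become
   identities in Q[e_1, e_2, ...], which embeds in a polynomial ring Q[x] by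
   the fundamental theorem on symmetric polynomials, and there they concern
   products of series 1 + x t.

   On Z[L] let psi^k(T^u) = T^(ku). If S kills f, then S kills g, as g is the
   image of f under a differential operator. Evaluating S . g = 0 at x / k and
   using that g is homogeneous shows that psi^k(S) kills g, hence also f. So
   the psi^k descend to K_f and to Q (x) K_f. Finally K_f is torsion-free, so
   it embeds in Q (x) K_f, and the subgroup of those x for which lam x has all
   its coefficients in K_f contains the generators T^u. *)

Require Import Defs.
From HB Require Import structures.
From mathcomp Require Import all_boot all_order all_algebra.
From mathcomp Require Import freeg mpoly.
From mathcomp Require Import perm zify boolp.
Set Implicit Arguments.
Unset Strict Implicit.
Unset Printing Implicit Defensive.
Import GRing.Theory.
Local Open Scope ring_scope.

Lemma strong_rec (T : Type) (x0 : T) (F : nat -> (nat -> T) -> T) :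
    (forall n u v, (forall i, (i < n)%N -> u i = v i) -> F n u = F n v) ->
  exists u, forall n, u n = F n u.
Proof.
move=> FP.
(* [g n] is the table of the values below [n], with [x0] elsewhere; carrying a table makes the
   recursion structural. *)
pose g := fix g n := if n is m.+1 then
  fun i => if i == m then F m (g m) else g m i else fun=> x0.
have gE n i : (i < n)%N -> g n i = F i (g i).
  elim: n => // n IH; rewrite ltnS leq_eqVlt /= => /orP[/eqP->|lt].
    by rewrite eqxx.
  by rewrite (ltn_eqF lt) IH.
exists (fun n => F n (g n)) => n; apply: FP => i lt; exact: gE.
Qed.

(** * Power series *)

Section PowerSeriesTheory.
Variable R : comPzRingType.
Implicit Types (a b c p q : pseries R) (x : R).

Lemma eq_ps_mul a a' b b' : a =1 a' -> b =1 b' -> ps_mul a b =1 ps_mul a' b'.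
Proof. by move=> ha hb k; apply: eq_bigr => i _; rewrite ha hb. Qed.

Lemma ps_mul_rev a b k : ps_mul a b k = \sum_(i < k.+1) a (k - i)%N * b i.
Proof.
rewrite /ps_mul (reindex_inj rev_ord_inj) /=.
by apply: eq_bigr => i _; rewrite subSS subKn ?leq_ord.
Qed.

Lemma ps_mulC a b : ps_mul a b =1 ps_mul b a.
Proof. by move=> k; rewrite ps_mul_rev; apply: eq_bigr => i _; rewrite mulrC. Qed.

Lemma ps_mulA a b c : ps_mul a (ps_mul b c) =1 ps_mul (ps_mul a b) c.
Proof.
move=> k; rewrite [RHS]ps_mul_rev.
(* [i] and [j] index [a] and [c], leaving [k - i - j] for [b]; both sides sum [G] over i + j <=
   k. *)
pose G i j := a i * (b (k - i - j)%N * c j).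
transitivity (\sum_(i < k.+1) \sum_(j < k.+1 | (j <= k - i)%N) G i j).
  apply: eq_bigr => i _; rewrite ps_mul_rev mulr_sumr.
  by rewrite (big_ord_narrow_leq (leq_subr _ _)).
rewrite (exchange_big_dep xpredT) //=; apply: eq_bigr => j _.
rewrite (eq_bigl (fun i : 'I_k.+1 => (i <= k - j)%N)); last first.
  by move=> i; have := ltn_ord i; have := ltn_ord j; lia.
rewrite (big_ord_narrow_leq (leq_subr _ _)) mulr_suml /=.
by apply: eq_bigr => i _; rewrite /G mulrA -!subnDA addnC.
Qed.

Lemma ps_mulDl a b c k :
  ps_mul (fun i => a i + b i) c k = ps_mul a c k + ps_mul b c k.
Proof. by rewrite -big_split; apply: eq_bigr => i _; rewrite /= mulrDl. Qed.

Lemma ps_mul1 a : ps_mul (ps_one R) a =1 a.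
Proof.
move=> k; rewrite /ps_mul big_ord_recl subn0 mul1r big1 ?addr0 // => i _.
by rewrite mul0r.
Qed.

(** The coefficients of the inverse are solved for one by one; as the constant term is 1, no
    division occurs. *)
Lemma ps_unit_ex_inv a : a 0%N = 1 -> ps_unit a.
Proof.
move=> a0.
have [b bE] : exists b : pseries R, forall k, b k =
    if k is k'.+1 then - \sum_(i < k) a i.+1 * b (k' - i)%N else 1.
  apply: (strong_rec 0) => -[//|n] u v uv; congr (- _).
  by apply: eq_bigr => i _; rewrite uv //; have := ltn_ord i; lia.
exists b => -[|k]; rewrite /ps_mul big_ord_recl a0 mul1r subn0.
  by rewrite big_ord0 addr0 bE.
rewrite bE /ps_one /= addrC -[RHS](subrr (\sum_(i < k.+1) a i.+1 * b (k - i)%N)).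
by congr (_ - _).
Qed.

End PowerSeriesTheory.

(** * Newton's identities *)

Section Newton.
Variable R : comPzRingType.
Implicit Types (a b c p q : pseries R) (x : R).

(* The entry p 0 is never used. *)
Definition newton_series p : pseries R :=
  fun k => if k is i.+1 then (-1) ^+ i * p k else 0.

(** The relation t a'(t) = N(t) a(t), where N is [newton_series p]; with the denominator cleared,
    nothing is inverted. *)
Definition newton a p : Prop :=
  a 0%N = 1 /\ forall k, a k *+ k = ps_mul (newton_series p) a k.

Lemma newton0E a p : newton a p -> a 0%N = 1. Proof. by case. Qed.

Lemma newton1E a p : newton a p -> a 1%N = p 1%N.
Proof.
case=> a0 /(_ 1%N); rewrite mulr1n => ->.
by rewrite /ps_mul big_ord_recl big_ord1 /= mul0r add0r a0 mulr1 mul1r.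
Qed.

Lemma eq_newton a b p q : a =1 b -> (forall i, (0 < i)%N -> p i = q i) ->
  newton a p -> newton b q.
Proof.
move=> ab pq [a0 aE]; split=> [|k]; rewrite -ab //; rewrite aE.
by apply: eq_ps_mul => // -[|i] //=; rewrite pq.
Qed.

(** Leibniz rule for t d/dt: logarithmic derivatives turn products into sums. *)
Lemma newton_mul a b p q : newton a p -> newton b q ->
  newton (ps_mul a b) (fun i => p i + q i).
Proof.
move=> [a0 aE] [b0 bE]; split; first by rewrite /ps_mul big_ord1 a0 b0 mulr1.
move=> k.
have -> : ps_mul a b k *+ k =
    ps_mul (fun i => a i *+ i) b k + ps_mul a (fun i => b i *+ i) k.
  rewrite /ps_mul -sumrMnl -big_split; apply: eq_bigr => i _ /=.
  by rewrite mulrnAl mulrnAr -mulrnDr subnKC ?leq_ord.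
rewrite (eq_ps_mul (b' := b) aE) // (eq_ps_mul (a' := a) _ bE) //.
rewrite -[ps_mul (ps_mul _ _) _ _]ps_mulA.
rewrite [X in _ + X]ps_mulC -[ps_mul (ps_mul _ b) _ _]ps_mulA.
rewrite [X in _ + X](eq_ps_mul (a' := newton_series q) _ (ps_mulC b a)) //.
rewrite -ps_mulDl; apply: eq_ps_mul => // -[|i] /=; first by rewrite addr0.
by rewrite mulrDr.
Qed.

(** This is the substitution of x t for t. *)
Lemma newton_scale a p x : newton a p ->
  newton (fun k => a k * x ^+ k) (fun i => p i * x ^+ i).
Proof.
move=> [a0 aE]; split=> [|k]; first by rewrite a0 mulr1.
rewrite -mulrnAl aE /ps_mul mulr_suml; apply: eq_bigr => -[[|i] ilt] _ /=.
  by rewrite !mul0r.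
by rewrite (mulrA _ (p _)) [RHS]mulrACA -exprD subnKC.
Qed.

Lemma newton_one : newton (ps_one R) (fun=> 0).
Proof.
split=> // k; rewrite /ps_mul big1 => [|[[|i] ilt] _] /=; last 2 first.
- by rewrite mul0r.
- by rewrite mulr0 mul0r.
by case: k => //= k; rewrite mul0rn.
Qed.

Lemma newton_lin x : newton (ps_lin x) (fun i => x ^+ i).
Proof.
split=> // k; rewrite /ps_mul; case: k => [|[|k]].
- by rewrite big_ord1 mul0r.
- by rewrite big_ord_recl big_ord1 /= mul0r add0r mul1r mulr1.
(* From degree 2 on, only the terms with [ps_lin x] at 1 and at 0 survive, and their signs make them
   cancel. *)
rewrite [X in X *+ _]nth_default // mul0rn big_ord_recr big_ord_recr big1 /=.
  rewrite add0r subnn subSnn /ps_lin /= mulr1 -mulrA -exprSr.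
  by rewrite [(-1) ^+ k.+1]exprS mulN1r mulNr subrr.
move=> i _; rewrite [ps_lin _ _]nth_default ?mulr0 //=.
by have := ltn_ord i; lia.
Qed.

(** In the i-th identity [p i] has the coefficient [a 0] = 1 up to sign, so it can be solved for
    over any ring. *)
Lemma newton_p_ext n a b p q : newton a p -> newton b q ->
    (forall i, (i <= n)%N -> a i = b i) ->
  forall i, (0 < i <= n)%N -> p i = q i.
Proof.
move=> [a0 aE] [b0 bE] ab; elim/ltn_ind => -[//|i] IH /= lt.
have := aE i.+1; rewrite ab // bE /ps_mul [LHS]big_ord_recr [RHS]big_ord_recr /=.
rewrite !subnn a0 b0 !mulr1.
have -> : \sum_(j < i.+1) newton_series q j * b (i.+1 - j)%N =
          \sum_(j < i.+1) newton_series p j * a (i.+1 - j)%N.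
  apply: eq_bigr => -[[|j] jlt] _ /=; first by rewrite !mul0r.
  rewrite IH ?ab //; try lia.
move/addrI => E; have := congr1 ( *%R ((-1) ^+ i)) E.
by rewrite !signrMK.
Qed.

Lemma newton_ex_p a : a 0%N = 1 -> exists p, newton a p.
Proof.
move=> a0.
have [p pE] : exists p : pseries R, forall k, p k = (-1) ^+ k.-1 *
    (a k *+ k - \sum_(i < k) newton_series p i * a (k - i)%N).
  apply: (strong_rec 0) => n u v uv; congr (_ * (_ - _)).
  by apply: eq_bigr => -[[|i] ilt] _ //=; rewrite uv.
exists p; split=> // -[|k]; first by rewrite /ps_mul big_ord1 mul0r.
rewrite /ps_mul big_ord_recr /= subnn a0 mulr1 pE signrMK addrC.
by rewrite subrK.
Qed.

Definition torsion_free : Prop := forall (x : R) n, x *+ n.+1 = 0 -> x = 0.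
Definition divisible : Prop := forall (x : R) n, exists y, y *+ n.+1 = x.

(** In this direction the i-th identity yields only [a i *+ i], whence the condition on torsion. *)
Lemma newton_ext n a b p q : torsion_free -> newton a p -> newton b q ->
    (forall i, (0 < i <= n)%N -> p i = q i) ->
  forall i, (i <= n)%N -> a i = b i.
Proof.
move=> tf [a0 aE] [b0 bE] pq; elim/ltn_ind => -[|i] IH lt; first by rewrite a0.
apply/eqP; rewrite -subr_eq0; apply/eqP/(tf _ i); rewrite mulrnBl aE bE.
apply/eqP; rewrite subr_eq0; apply/eqP/eq_bigr => -[[|j] jlt] _ /=.
  by rewrite !mul0r.
by rewrite IH ?pq //; lia.
Qed.

Lemma newton_ex p : divisible -> exists a, newton a p.
Proof.
move=> dv; have /choice[d dE] : forall xn : R * nat, exists y, y *+ xn.2.+1 = xn.1.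
  by case=> x n; exact: dv.
have [a aE] : exists a : pseries R, forall k, a k = if k is k'.+1 then
    d (\sum_(i < k) newton_series p i.+1 * a (k' - i)%N, k') else 1.
  apply: (strong_rec 0) => -[//|n] u v uv; congr (d (_, _)).
  by apply: eq_bigr => i _; rewrite uv //; have := ltn_ord i; lia.
exists a; split=> [|[|k]]; first by rewrite aE.
  by rewrite /ps_mul big_ord1 mul0r.
by rewrite {1}aE dE /ps_mul [RHS]big_ord_recl mul0r add0r.
Qed.

End Newton.

Lemma newton_rmorph (R S : comPzRingType) (h : {rmorphism R -> S}) a p :
  newton a p -> newton (h \o a) (h \o p).
Proof.
move=> [a0 aE]; split=> [|k] /=; first by rewrite a0 rmorph1.
rewrite -raddfMn aE /ps_mul raddf_sum; apply: eq_bigr => -[[|i] ilt] _ /=.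
  by rewrite !rmorphM rmorph0.
by rewrite !rmorphM rmorphXn rmorphN1.
Qed.

(** A morphism from [rat] records a Q-algebra structure in a way that admits the zero ring. *)
Lemma rat_torsion_free (R : comPzRingType) (f : {rmorphism rat -> R}) :
  torsion_free R.
Proof.
have nz n : n.+1%:R != 0 :> rat by rewrite Num.Theory.pnatr_eq0.
move=> x n x0; rewrite -[x]mul1r -(rmorph1 f) -(mulVf (nz n)).
by rewrite rmorphM rmorph_nat -mulrA mulr_natl x0 mulr0.
Qed.

Lemma rat_divisible (R : comPzRingType) (f : {rmorphism rat -> R}) : divisible R.
Proof.
move=> x n; exists (f n.+1%:R^-1 * x).
rewrite -[LHS]mulr_natl mulrA -(rmorph_nat f) -rmorphM.
by rewrite mulfV ?Num.Theory.pnatr_eq0 // rmorph1 mul1r.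
Qed.

(** * Products of polynomials and their power sums *)

Section NewtonPoly.
Variable R : comNzRingType.

Lemma newton_prod_poly (I : Type) (r : seq I) (D : pred I) (u : I -> {poly R})
    (v : I -> pseries R) :
    (forall j, newton (fun k => (u j)`_k) (v j)) ->
  newton (fun k => (\prod_(j <- r | D j) u j)`_k)
         (fun i => \sum_(j <- r | D j) v j i).
Proof.
move=> uv; elim: r => [|j r IH].
  apply: eq_newton (newton_one R) => [k|i _]; rewrite big_nil //.
  by rewrite coef1.
have [Dj|Dj] := boolP (D j); last first.
  by apply: eq_newton IH => [k|i _]; rewrite big_cons (negbTE Dj).
apply: eq_newton (newton_mul (uv j) IH) => [k|i _]; rewrite big_cons Dj //.
by rewrite coefM.
Qed.

Lemma newton_linear_poly (x : R) :
  newton (fun k => (1 + x *: 'X : {poly R})`_k) (fun i => x ^+ i).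
Proof.
apply: eq_newton (newton_lin x) => // k; rewrite coefD coef1 coefZ coefX.
by case: k => [|[|k]]; rewrite /ps_lin /= ?mulr0 ?mulr1 ?addr0 ?add0r // nth_nil.
Qed.

(** When the product is expanded, [h] is the set of factors contributing [y j *: 'X] rather than
    1. *)
Lemma coef_prod_linear (I : finType) (y : I -> R) k :
  (\prod_j (1 + y j *: 'X))`_k = \sum_(h : {set I} | #|h| == k) \prod_(j in h) y j.
Proof.
have E : \prod_j (1 + y j *: 'X) =
    \sum_(h : {set I}) (\prod_(j in h) y j) *: 'X^(#|h|) :> {poly R}.
  rewrite (eq_bigr (fun j => y j *: 'X + 1)) => [|j _]; last by rewrite addrC.
  rewrite bigA_distr; apply: eq_bigr => h _.
  rewrite -big_mkcond /= (eq_bigr (fun j => (y j)%:P * 'X)) => [|j _].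
    by rewrite big_split /= prodr_const -mul_polyC rmorph_prod.
  by rewrite mul_polyC.
rewrite E coef_sum [RHS]big_mkcond; apply: eq_bigr => h _.
by rewrite coefZ coefXn eq_sym; case: eqP; rewrite ?mulr1 ?mulr0.
Qed.

(** [int_eval] makes sense over the zero ring too; over a nonzero ring it is [mmap], whose theory
    then applies. *)
Lemma int_evalE n (p : {mpoly int[n]}) (v : 'I_n -> R) :
  int_eval p v = mmap intr v p.
Proof. by apply: eq_bigr => m _; rewrite mulrzl. Qed.

End NewtonPoly.

Lemma int_eval_rmorph (R S : comPzRingType) (h : {rmorphism R -> S}) n
    (p : {mpoly int[n]}) v : h (int_eval p v) = int_eval p (h \o v).
Proof.
rewrite raddf_sum; apply: eq_bigr => m _.
rewrite raddfMz /=; congr (_ *~ _); rewrite rmorph_prod.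
by apply: eq_bigr => i _; rewrite rmorphXn.
Qed.

Lemma eq_int_eval (R : comPzRingType) n (p : {mpoly int[n]}) (u v : 'I_n -> R) :
  u =1 v -> int_eval p u = int_eval p v.
Proof.
move=> uv; apply: eq_bigr => m _; congr (_ *~ _).
by apply: eq_bigr => i _; rewrite uv.
Qed.

(* K f is the zero ring when f = 0, and polynomials need nonzero rings. *)
Lemma comPzRing_ind (Q : comPzRingType -> Prop) :
    (forall R : comPzRingType, (1 : R) = 0 -> Q R) ->
    (forall R : comNzRingType, Q R) ->
  forall R, Q R.
Proof.
move=> h0 h1 [T c]; pose R : comPzRingType := GRing.ComPzRing.Pack c.
have [/eqP e|ne] := boolP ((1 : R) == 0); first exact: h0.
pose m := GRing.PzSemiRing_isNonZero.Build R ne.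
pose R' : comNzRingType := HB.pack (GRing.ComPzRing.sort R) m.
exact: (h1 R').
Qed.

Lemma one_eq0 (R : comPzRingType) : (1 : R) = 0 -> forall x y : R, x = y.
Proof. by move=> e x y; rewrite -[x]mul1r -[y]mul1r e !mul0r. Qed.

(** * Universal polynomials *)

Lemma rmorph_mmap (A B T : comNzRingType) (f : {rmorphism A -> B})
    (h : {rmorphism B -> T}) n (v : 'I_n -> B) (p : {mpoly A[n]}) :
  h (mmap f v p) = mmap (h \o f) (h \o v) p.
Proof.
rewrite raddf_sum /=; apply: eq_bigr => m _; rewrite rmorphM rmorph_prod.
by congr (_ * _); apply: eq_bigr => i _; rewrite rmorphXn.
Qed.

Lemma eq_mmap (A B : comNzRingType) (f g : A -> B) n (u v : 'I_n -> B) p :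
  f =1 g -> u =1 v -> mmap f u p = mmap g v p.
Proof.
move=> fg uv; apply: eq_bigr => m _; rewrite fg; congr (_ * _).
by apply: eq_bigr => i _; rewrite uv.
Qed.

Lemma mmap_comp_mpoly (A B : comNzRingType) (f : {rmorphism A -> B}) n k
    (v : 'I_k -> B) (s : n.-tuple {mpoly A[k]}) (p : {mpoly A[n]}) :
  mmap f v (p \mPo s) = mmap f (fun i => mmap f v (tnth s i)) p.
Proof.
rewrite rmorph_mmap; apply: eq_mmap => // c /=; exact: mmapC.
Qed.

(* 1 + u_0 t + ... + u_(n-1) t^n *)
Definition extend1 (T : comPzRingType) n (u : 'I_n -> T) : pseries T :=
  fun a => if a is i.+1 then oapp u 0 (insub i) else 1.

Lemma extend1_small (T : comPzRingType) n (c : pseries T) a :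
  c 0%N = 1 -> (a <= n)%N -> extend1 (fun i : 'I_n => c i.+1) a = c a.
Proof. by case: a => [//|a] c0 lt; rewrite /= insubT. Qed.

Lemma extend1_big (T : comPzRingType) n (u : 'I_n -> T) a :
  (n < a)%N -> extend1 u a = 0.
Proof. by case: a => // a lt; rewrite /= insubF // ltnNge -ltnS lt. Qed.

Lemma rmorph_extend1 (T U : comPzRingType) (h : {rmorphism T -> U}) n
    (u : 'I_n -> T) a : h (extend1 u a) = extend1 (h \o u) a.
Proof.
case: a => [|a] /=; first exact: rmorph1.
by case: insubP => [i _ _|_] //=; exact: rmorph0.
Qed.

Definition esym_value (T : comPzRingType) n (y : 'I_n -> T) : pseries T :=
  fun a => \sum_(h : {set 'I_n} | #|h| == a) \prod_(j in h) y j.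

Lemma esym_value0 (T : comPzRingType) n (y : 'I_n -> T) : esym_value y 0 = 1.
Proof.
rewrite /esym_value (eq_bigl (pred1 set0)) => [|h]; last by rewrite cards_eq0.
by rewrite big_pred1_eq big_set0.
Qed.

Lemma esym_value_big (T : comPzRingType) n (y : 'I_n -> T) a :
  (n < a)%N -> esym_value y a = 0.
Proof.
move=> lt; rewrite /esym_value big_pred0 // => h; apply/eqP => e.
by have := max_card h; rewrite e card_ord leqNgt lt.
Qed.

Lemma esym_value_extend1 (T : comPzRingType) n (y : 'I_n -> T) :
  esym_value y =1 extend1 (fun i : 'I_n => esym_value y i.+1).
Proof.
move=> a; have [le|lt] := leqP a n; last by rewrite esym_value_big ?extend1_big.
by rewrite extend1_small ?esym_value0.
Qed.

Lemma mmap_mesym (A B : comNzRingType) (f : {rmorphism A -> B}) n (y : 'I_n -> B) a :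
  mmap f y (mesym n A a) = esym_value y a.
Proof.
rewrite /mesym raddf_sum /=; apply: eq_bigr => h _; rewrite rmorph_prod.
by apply: eq_bigr => i _ /=; rewrite mmapX mmap1U.
Qed.

(** The generating polynomial is the product of the 1 + y_j t, and each factor contributes the
    powers of one y_j. *)
Lemma newton_esym_value (R : comNzRingType) n (y : 'I_n -> R) :
  newton (esym_value y) (fun i => \sum_j y j ^+ i).
Proof.
apply: eq_newton (newton_prod_poly (index_enum _) xpredT
  (fun j => newton_linear_poly (y j))) => // k.
exact: coef_prod_linear.
Qed.

(** * The universal polynomials for products *)

Section Twist.
Variable k : nat.

(* For l = e(x) the coefficient of t^k in prod_(i, j) (1 + x_i y_j t), which
   makes sense for an arbitrary series l. *)
Definition twist (T : comNzRingType) (l : pseries T) (y : 'I_k -> T) : T :=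
  (\prod_(j < k) \poly_(a < k.+1) (l a * y j ^+ a))`_k.

Lemma eq_twist (T : comNzRingType) (l l' : pseries T) (y y' : 'I_k -> T) :
  l =1 l' -> y =1 y' -> twist l y = twist l' y'.
Proof.
move=> hl hy; rewrite /twist; congr ((polyseq _)`_k); apply: eq_bigr => j _.
by apply/polyP => i; rewrite !coef_poly hl hy.
Qed.

Lemma rmorph_twist (T U : comNzRingType) (h : {rmorphism T -> U}) l y :
  h (twist l y) = twist (h \o l) (h \o y).
Proof.
rewrite /twist -coef_map rmorph_prod; congr ((polyseq _)`_k); apply: eq_bigr => j _.
apply/polyP => i; rewrite coef_map !coef_poly; case: ifP => _ /=.
  by rewrite rmorphM rmorphXn.
exact: rmorph0.
Qed.

Lemma twist_perm (T : comNzRingType) (l : pseries T) (y : 'I_k -> T) (s : 'S_k) :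
  twist l (y \o s) = twist l y.
Proof. by rewrite /twist [in RHS](reindex_inj (@perm_inj _ s)). Qed.

(** The series of the l_a y_j^a has power sums p_i y_j^i, and the product over j adds these up. As
    [l] vanishes beyond [k], truncating the factors loses nothing. *)
Lemma twist_newton (T : comNzRingType) (l c p : pseries T) (y : 'I_k -> T) :
    torsion_free T -> (forall a, (k < a)%N -> l a = 0) -> newton l p ->
    newton c (fun i => p i * \sum_j y j ^+ i) -> c k = twist l y.
Proof.
move=> tf l0 lp cp.
have H : newton (fun a => (\prod_(j < k) \poly_(a < k.+1) (l a * y j ^+ a))`_a)
    (fun i => \sum_(j < k) p i * y j ^+ i).
  apply: newton_prod_poly => j; apply: eq_newton (newton_scale (y j) lp) => // a.
  by rewrite coef_poly; case: ltnP => // lt; rewrite l0 ?mul0r.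
by apply: (newton_ext tf cp H _ (leqnn k)) => i _; rewrite mulr_sumr.
Qed.

(** The inner variables stand for the e_i(x), the outer ones for the y_j, so that only the y_j
    remain to be symmetrized. *)
Definition prod_gen : {mpoly {mpoly int[k]}[k]} :=
  twist (extend1 (fun i : 'I_k => ('X_i : {mpoly int[k]})%:MP)) (fun j => 'X_j).

Lemma prod_gen_sym : prod_gen \is symmetric.
Proof.
apply/issymP => s.
(* [h] is the action of [s] by conversion: it permutes the outer variables and fixes the
   coefficients. *)
pose h : {rmorphism {mpoly {mpoly int[k]}[k]} -> {mpoly {mpoly int[k]}[k]}} :=
  mmap (@mpolyC _ _) (fun i => 'X_(s i)).
rewrite -[LHS]/(h prod_gen) rmorph_twist /prod_gen.
rewrite -[in RHS](twist_perm _ _ s); apply: eq_twist => [a|j] /=.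
  rewrite rmorph_extend1; congr (extend1 _ a); apply: funext => i /=.
  exact: mmapC.
by rewrite mmapX mmap1U.
Qed.

Definition mmap2 (T : comNzRingType) (u v : 'I_k -> T)
  : {mpoly {mpoly int[k]}[k]} -> T := mmap (mmap intr u) v.

(** [symf] expresses [prod_gen] through the e_j(y); [mmap2] then merges the two layers of
    variables. *)
Definition lambda_prod_poly : {mpoly int[k + k]} :=
  mmap2 (fun i => 'X_(lshift k i)) (fun i => 'X_(rshift k i)) (symf prod_gen).

Lemma int_eval_lambda_prod_poly (T : comNzRingType) (w : 'I_(k + k) -> T) :
  int_eval lambda_prod_poly w =
  mmap2 (fun i => w (lshift k i)) (fun i => w (rshift k i)) (symf prod_gen).
Proof.
rewrite int_evalE /lambda_prod_poly /mmap2 rmorph_mmap; apply: eq_mmap => [c|i] /=.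
  rewrite rmorph_mmap; apply: eq_mmap => [z|i] /=; first by rewrite rmorph_int.
  by rewrite mmapX mmap1U.
by rewrite mmapX mmap1U.
Qed.

(** Substituting the e_i(y) undoes [symf]. *)
Lemma mmap2_prod_gen (T : comNzRingType) (u y : 'I_k -> T) :
  mmap2 u (fun i => esym_value y i.+1) (symf prod_gen) = twist (extend1 u) y.
Proof.
transitivity (mmap2 u y prod_gen).
  rewrite [in RHS](symfP prod_gen_sym) /mmap2 mmap_comp_mpoly.
  by apply: eq_mmap => // i; rewrite tnth_mktuple mmap_mesym.
rewrite /mmap2 /prod_gen rmorph_twist; apply: eq_twist => [a|j] /=.
  rewrite rmorph_extend1; congr (extend1 _ a); apply: funext => i /=.
  by rewrite mmapC /= mmapX mmap1U.
by rewrite mmapX mmap1U.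
Qed.

Lemma int_eval_lambda_prod_poly_twist (T : comNzRingType) (w : 'I_(k + k) -> T)
    (y : 'I_k -> T) : (forall i, w (rshift k i) = esym_value y i.+1) ->
  int_eval lambda_prod_poly w = twist (extend1 (fun i => w (lshift k i))) y.
Proof.
move=> wy; rewrite int_eval_lambda_prod_poly -mmap2_prod_gen.
by apply: eq_mmap => // i; exact: wy.
Qed.

Lemma split_lshift m n (i : 'I_m) : split (lshift n i) = inl i.
Proof. exact: (unsplitK (inl i)). Qed.

Lemma split_rshift m n (i : 'I_n) : split (rshift m i) = inr i.
Proof. exact: (unsplitK (inr i)). Qed.

(** For fixed j the product over i of the 1 + x_i y_j t has coefficients e_a(x) y_j^a, so the double
    product is a [twist]. *)
Lemma lambda_prod_poly_universal : universal_prod lambda_prod_poly.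
Proof.
rewrite /universal_prod.
rewrite (@int_eval_lambda_prod_poly_twist _ _ (fun j => 'X_(rshift k j))); last first.
  by move=> i; rewrite /esym2 split_rshift int_evalE mmap_mesym.
rewrite exchange_big /twist; congr ((polyseq _)`_k); apply: eq_bigr => j _.
apply/polyP => a.
rewrite (eq_bigr (fun i => 1 + ('X_(rshift k j) * 'X_(lshift k i)) *: 'X)); last first.
  by move=> i _; rewrite mulrC.
rewrite coef_prod_linear coef_poly.
transitivity (esym_value (fun i => 'X_(lshift k i) : {mpoly int[k + k]}) a
              * 'X_(rshift k j) ^+ a).
  case: ltnP => lt; last by rewrite esym_value_big ?mul0r.
  rewrite esym_value_extend1; congr (extend1 _ a * _); apply: funext => i.
  by rewrite /esym2 split_lshift int_evalE mmap_mesym.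
rewrite mulr_suml; apply: eq_bigr => h /eqP <-.
by rewrite big_split /= prodr_const mulrC.
Qed.

(** The generic case, where a_i and b_i are variables X_i and Y_i of V = Q[X][Y] for 0 < i <= k, is
    proved first and then specialized. In V one may pass from Y_i to e_i(Y), where [twist_newton]
    applies. *)
Lemma newton_prod_nz (R : comNzRingType) (f : {rmorphism rat -> R})
    (a b c p q : pseries R) :
    newton a p -> newton b q -> newton c (fun i => p i * q i) ->
  c k = int_eval lambda_prod_poly (fun i => match split i with
                                     | inl j => a j.+1
                                     | inr j => b j.+1
                                     end).
Proof.
move=> ap bq cpq.
pose V : comNzRingType := {mpoly {mpoly rat[k]}[k]}.
pose fV : {rmorphism rat -> V} := @mpolyC k {mpoly rat[k]} \o @mpolyC k rat.
have tfV := rat_torsion_free fV; have dvV := rat_divisible fV.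
pose X i : V := ('X_i)%:MP; pose Y i : V := 'X_i.
pose w (i : 'I_(k + k)) := match split i with inl j => X j | inr j => Y j end.
have [P XP] := newton_ex_p (erefl : extend1 X 0 = 1).
have [Q YQ] := newton_ex_p (erefl : extend1 Y 0 = 1).
have [C CPQ] := newton_ex (fun i => P i * Q i) dvV.
have CE : C k = int_eval lambda_prod_poly w.
  (* Substituting e_i(Y) for Y_i is injective, so the identity may be checked after the
     substitution. *)
  apply: msym_fundamental_un.
  set S := [tuple _ | _ < _].
  pose h : {rmorphism V -> V} := comp_mpoly S.
  rewrite -[LHS]/(h (C k)) -[RHS]/(h (int_eval lambda_prod_poly w)) int_eval_rmorph.
  have hX i : h (X i) = X i by exact: comp_mpolyC.
  have hY i : h (Y i) = esym_value Y i.+1.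
    by rewrite /h /= comp_mpolyXU -tnth_nth tnth_mktuple.
  rewrite (@int_eval_lambda_prod_poly_twist _ _ Y); last first.
    by move=> i; rewrite /w /= split_rshift hY.
  have -> : (fun i => (h \o w) (lshift k i)) = X.
    by apply: funext => i; rewrite /w /= split_lshift hX.
  have hXP : newton (extend1 X) (h \o P).
    apply: eq_newton (newton_rmorph h XP) => // i /=.
    rewrite rmorph_extend1; congr (extend1 _ i); apply: funext => j; exact: hX.
  have hYQ : newton (esym_value Y) (h \o Q).
    apply: eq_newton (newton_rmorph h YQ) => // i /=.
    rewrite rmorph_extend1 esym_value_extend1; congr (extend1 _ i).
    apply: funext => j; exact: hY.
  apply: (@twist_newton _ _ (h \o C) _ Y tfV _ hXP) => [a' lt|].
    exact: extend1_big.
  apply: eq_newton (newton_rmorph h CPQ) => // i i0 /=; rewrite rmorphM.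
  congr (_ * _); rewrite -/((h \o Q) i).
  by rewrite (newton_p_ext (n := i) hYQ (newton_esym_value Y)) // i0 leqnn.
pose h : {rmorphism V -> R} :=
  mmap (mmap f (fun i : 'I_k => a i.+1)) (fun i : 'I_k => b i.+1).
have hX i : h (X i) = a i.+1 by rewrite /h /= mmapC /= mmapX mmap1U.
have hY i : h (Y i) = b i.+1 by rewrite /h /= mmapX mmap1U.
transitivity (h (C k)); last first.
  rewrite CE int_eval_rmorph; apply: eq_int_eval => i /=.
  by rewrite /w; case: (split i) => j; rewrite ?hX ?hY.
apply/esym.
(* The specialized series agree with [a] and [b] up to degree [k], which determines the coefficient
   of degree [k]. *)
apply: (newton_ext (rat_torsion_free f) (newton_rmorph h CPQ) cpq _ (leqnn k)).
move=> i ilt /=; rewrite rmorphM; congr (_ * _).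
  apply: (newton_p_ext (n := k) (newton_rmorph h XP) ap) => // j jlt /=.
  rewrite rmorph_extend1 -[RHS](extend1_small (newton0E ap) jlt).
  by congr (extend1 _ j); apply: funext => m; exact: hX.
apply: (newton_p_ext (n := k) (newton_rmorph h YQ) bq) => // j jlt /=.
rewrite rmorph_extend1 -[RHS](extend1_small (newton0E bq) jlt).
by congr (extend1 _ j); apply: funext => m; exact: hY.
Qed.

Lemma newton_prod (R : comPzRingType) (f : {rmorphism rat -> R})
    (a b c p q : pseries R) :
    newton a p -> newton b q -> newton c (fun i => p i * q i) ->
  c k = int_eval lambda_prod_poly (fun i => match split i with
                                     | inl j => a j.+1
                                     | inr j => b j.+1
                                     end).
Proof.
elim/comPzRing_ind: R f a b c p q => [R /one_eq0 e|R] f a b c p q.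
  by move=> *; apply: e.
exact: newton_prod_nz.
Qed.

End Twist.

(** * The universal polynomials for compositions *)

Section Composition.
Variables k l : nat.

Definition comp_gen : {mpoly int[k * l]} :=
  (\prod_(h : {set 'I_(k * l)} | #|h| == l) (1 + (\prod_(i in h) 'X_i) *: 'X))`_k.

Lemma mmap_comp_gen (T : comNzRingType) (u : 'I_(k * l) -> T) :
  mmap intr u comp_gen =
  (\prod_(h : {set 'I_(k * l)} | #|h| == l) (1 + (\prod_(i in h) u i) *: 'X))`_k.
Proof.
rewrite /comp_gen -coef_map rmorph_prod; congr ((polyseq _)`_k).
apply: eq_bigr => h _; rewrite rmorphD rmorph1 /= map_polyZ map_polyX /= rmorph_prod.
by congr (_ + _ *: _); apply: eq_bigr => i _; rewrite /= mmapX mmap1U.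
Qed.

(** A permutation of the variables permutes the subsets of size [l], hence the factors. *)
Lemma comp_gen_sym : comp_gen \is symmetric.
Proof.
apply/issymP => s.
rewrite /msym (eq_mmap (g := intr) (v := fun i => 'X_(s i)) _ _) // => [|c].
  rewrite mmap_comp_gen /comp_gen; congr ((polyseq _)`_k).
  rewrite [RHS](reindex_inj (@imset_inj _ _ s (@perm_inj _ s))) /=.
  apply: eq_big => [h|h _]; first by rewrite card_imset //; exact: perm_inj.
  by rewrite big_imset //= => i j _ _; exact: perm_inj.
by rewrite -[c in LHS]intz rmorph_int.
Qed.

Definition lambda_comp_poly := symf comp_gen.

Lemma int_eval_lambda_comp_poly (T : comNzRingType) (y : 'I_(k * l) -> T) :
  int_eval lambda_comp_poly (fun i => esym_value y i.+1) =
  (\prod_(h : {set 'I_(k * l)} | #|h| == l) (1 + (\prod_(i in h) y i) *: 'X))`_k.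
Proof.
rewrite -mmap_comp_gen (symfP comp_gen_sym) mmap_comp_mpoly int_evalE.
by apply: eq_mmap => // i; rewrite tnth_mktuple mmap_mesym.
Qed.

Lemma lambda_comp_poly_universal : universal_comp lambda_comp_poly.
Proof. exact: int_eval_lambda_comp_poly. Qed.

(** If the p_i are the power sums of the x_j, then [b i] consists of the elementary symmetric
    functions of the x_j^i. As for products, the generic case is proved by passing to e_i(X) and is
    then specialized. *)
Lemma newton_comp_nz (R : comNzRingType) (f : {rmorphism rat -> R})
    (a c p : pseries R) (b : nat -> pseries R) :
    newton a p -> (forall i, (0 < i)%N -> newton (b i) (fun j => p (i * j)%N)) ->
    newton c (fun i => b i l) ->
  c k = int_eval lambda_comp_poly (fun i => a i.+1).
Proof.
move=> ap bp cb.
pose n := (k * l)%N.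
pose V : comNzRingType := {mpoly rat[n]}.
pose fV : {rmorphism rat -> V} := @mpolyC n rat.
have tfV := rat_torsion_free fV; have dvV := rat_divisible fV.
pose X (i : 'I_n) : V := 'X_i.
have [P XP] := newton_ex_p (erefl : extend1 X 0 = 1).
have /choice[B BP] : forall i, exists Bi, newton Bi (fun j => P (i * j)%N).
  by move=> i; exact: newton_ex.
have [C CB] := newton_ex (fun i => B i l) dvV.
have CE : C k = int_eval lambda_comp_poly X.
  apply: msym_fundamental_un.
  set S := [tuple _ | _ < _].
  pose h : {rmorphism V -> V} := comp_mpoly S.
  rewrite -[LHS]/(h (C k)) -[RHS]/(h (int_eval lambda_comp_poly X)) int_eval_rmorph.
  have hX i : h (X i) = esym_value X i.+1.
    by rewrite /h /= comp_mpolyXU -tnth_nth tnth_mktuple.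
  rewrite (@eq_int_eval _ _ _ _ (fun i => esym_value X i.+1)) //.
  rewrite int_eval_lambda_comp_poly.
  have hXP : newton (esym_value X) (h \o P).
    apply: eq_newton (newton_rmorph h XP) => // i /=.
    rewrite rmorph_extend1 esym_value_extend1; congr (extend1 _ i).
    apply: funext => j; exact: hX.
  have hP i : (0 < i)%N -> h (P i) = \sum_j X j ^+ i.
    move=> i0; rewrite -/((h \o P) i).
    by rewrite (newton_p_ext (n := i) hXP (newton_esym_value X)) // i0 leqnn.
  have hB i : (0 < i)%N -> h (B i l) = esym_value (fun j => X j ^+ i) l.
    move=> i0.
    apply: (newton_ext tfV (newton_rmorph h (BP i))
             (newton_esym_value (fun j => X j ^+ i)) _ (leqnn l)) => j /andP[j0 _] /=.
    rewrite hP ?muln_gt0 ?i0 //.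
    by apply: eq_bigr => m _; rewrite exprM.
  have H : newton
      (fun a => (\prod_(A : {set 'I_n} | #|A| == l) (1 + (\prod_(i in A) X i) *: 'X))`_a)
      (fun i => \sum_(A : {set 'I_n} | #|A| == l) (\prod_(j in A) X j) ^+ i).
    by apply: newton_prod_poly => A; exact: newton_linear_poly.
  apply: (newton_ext tfV (newton_rmorph h CB) H _ (leqnn k)) => i /andP[i0 _] /=.
  (* e_l of the i-th powers is the i-th power sum of the products of [l] distinct variables. *)
  rewrite hB //; apply: eq_bigr => A _.
  by rewrite prodrXl.
pose h : {rmorphism V -> R} := mmap f (fun i : 'I_n => a i.+1).
have hX i : h (X i) = a i.+1 by rewrite /h /= mmapX mmap1U.
transitivity (h (C k)); last first.
  by rewrite CE int_eval_rmorph; apply: eq_int_eval => i; exact: hX.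
have tfR := rat_torsion_free f.
(* [C k] depends on the [B i l] with i <= k, and these on the [P (i * j)] with j <= l; hence n = k l
   is large enough. *)
have hP i : (0 < i <= n)%N -> h (P i) = p i.
  apply: (newton_p_ext (n := n) (newton_rmorph h XP) ap) => j jlt /=.
  rewrite rmorph_extend1 -[RHS](extend1_small (newton0E ap) jlt).
  by congr (extend1 _ j); apply: funext => m; exact: hX.
apply/esym; apply: (newton_ext tfR (newton_rmorph h CB) cb _ (leqnn k)).
move=> i /andP[i0 ik] /=.
apply: (newton_ext tfR (newton_rmorph h (BP i)) (bp i i0) _ (leqnn l)).
by move=> j /andP[j0 jl] /=; apply: hP; rewrite muln_gt0 i0 j0 leq_mul.
Qed.

Lemma newton_comp (R : comPzRingType) (f : {rmorphism rat -> R})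
    (a c p : pseries R) (b : nat -> pseries R) :
    newton a p -> (forall i, (0 < i)%N -> newton (b i) (fun j => p (i * j)%N)) ->
    newton c (fun i => b i l) ->
  c k = int_eval lambda_comp_poly (fun i => a i.+1).
Proof.
elim/comPzRing_ind: R f a c p b => [R /one_eq0 e|R] f a c p b.
  by move=> *; apply: e.
exact: newton_comp_nz.
Qed.

End Composition.

(** * Lambda-rings from Adams operations *)

Section AdamsLambda.
Variables (R : comPzRingType) (f : {rmorphism rat -> R}).
Variable psi : nat -> {rmorphism R -> R}.
Hypothesis psi1 : forall x, psi 1%N x = x.
Hypothesis psiM : forall i j x, (0 < i)%N -> (0 < j)%N ->
  psi i (psi j x) = psi (i * j)%N x.
Variable lam : R -> pseries R.
Hypothesis lamP : forall x, newton (lam x) (fun i => psi i x).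

Lemma newton_unique (a b p q : pseries R) : newton a p -> newton b q ->
  (forall i, (0 < i)%N -> p i = q i) -> a =1 b.
Proof.
move=> ap bq pq k; apply: (newton_ext (rat_torsion_free f) ap bq _ (leqnn k)).
by move=> i /andP[i0 _]; exact: pq.
Qed.

Lemma adams_lamD x y : lam (x + y) =1 ps_mul (lam x) (lam y).
Proof.
apply: newton_unique (lamP _) (newton_mul (lamP x) (lamP y)) _ => i _.
exact: rmorphD.
Qed.

Lemma adams_lam_multiplicative : ps_multiplicative lam.
Proof.
split=> [x|]; last exact: adams_lamD.
by apply: ps_unit_ex_inv; exact: newton0E (lamP x).
Qed.

(** The psi^i x act as the power sums of x. Multiplicativity of psi^i gives the hypothesis of
    [newton_prod], and psi^i applied to the series [lam x] gives the [b i] of [newton_comp]. *)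
Lemma adams_lambda_ring : lambda_ring lam.
Proof.
split=> [x|x|k x y||k|k l].
- exact: newton0E (lamP x).
- by rewrite (newton1E (lamP x)) psi1.
- exact: adams_lamD.
- apply: newton_unique (lamP 1) (newton_lin 1) _ => i _.
  by rewrite rmorph1 expr1n.
- exists (lambda_prod_poly k); first exact: lambda_prod_poly_universal.
  move=> x y; apply: (newton_prod k f (lamP x) (lamP y)).
  by apply: eq_newton (lamP (x * y)) => // i _; rewrite rmorphM.
- exists (lambda_comp_poly k l); first exact: lambda_comp_poly_universal.
  move=> x.
  have bP i : (0 < i)%N -> newton (psi i \o lam x) (fun j => psi (i * j)%N x).
    move=> i0.
    by apply: eq_newton (newton_rmorph (psi i) (lamP x)) => // j j0 /=; rewrite psiM.
  exact: (newton_comp k f (lamP x) bP (lamP (lam x l))).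
Qed.

End AdamsLambda.

(** An injective morphism reflects identities, and integer polynomials commute with it, so the same
    universal polynomials serve. *)
Lemma sub_lambda_ring (R S : comPzRingType) (h : {rmorphism R -> S})
    (lam : R -> pseries R) (lamS : S -> pseries S) :
    injective h -> (forall x k, h (lam x k) = lamS (h x) k) ->
  lambda_ring lamS -> lambda_ring lam.
Proof.
move=> hI hl [l0 l1 lD lo lM lC]; split=> [x|x|k x y|k|k|k l].
- by apply: hI; rewrite hl l0 rmorph1.
- by apply: hI; rewrite hl l1.
- apply: hI; rewrite hl rmorphD lD raddf_sum; apply: eq_bigr => i _ /=.
  by rewrite rmorphM !hl.
- apply: hI; rewrite hl rmorph1 lo /ps_lin.
  by case: k => [|[|k]]; rewrite /= ?nth_nil ?rmorph1 ?rmorph0.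
- have [p pU pE] := lM k; exists p => // x y; apply: hI.
  rewrite hl rmorphM pE int_eval_rmorph; apply: eq_int_eval => i /=.
  by case: (split i) => j; rewrite hl.
- have [p pU pE] := lC k l; exists p => // x; apply: hI.
  by rewrite !hl pE int_eval_rmorph; apply: eq_int_eval => i /=; rewrite hl.
Qed.

(** * Uniqueness of multiplicative maps *)

Section MultiplicativeMaps.
Variables (R : comPzRingType) (lam lam' : R -> pseries R).
Hypotheses (lamM : ps_multiplicative lam) (lamM' : ps_multiplicative lam').

Lemma ps_unitI (a b c : pseries R) : ps_unit c ->
  ps_mul a c =1 ps_mul b c -> a =1 b.
Proof.
move=> [d cd] ab k.
have E (u : pseries R) : ps_mul (ps_mul u c) d k = u k.
  by rewrite -ps_mulA (eq_ps_mul (a' := u) _ cd) // ps_mulC ps_mul1.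
by rewrite -(E a) -(E b); exact: eq_ps_mul.
Qed.

(** With the value at 0, this makes the set where two multiplicative maps agree a subgroup; the unit
    [lam y] is cancelled. *)
Lemma ps_multiplicative_eqB x y :
  lam x =1 lam' x -> lam y =1 lam' y -> lam (x - y) =1 lam' (x - y).
Proof.
move=> hx hy; apply: (ps_unitI (proj1 lamM y)) => k.
rewrite -(proj2 lamM) subrK hx -{1}(subrK y x) (proj2 lamM').
exact: eq_ps_mul.
Qed.

Lemma ps_multiplicative_eq0 : lam 0 =1 lam' 0.
Proof.
have E l : ps_multiplicative l -> l 0 =1 ps_one R.
  move=> lM; apply: (ps_unitI (proj1 lM 0)) => k.
  by rewrite -(proj2 lM) addr0 ps_mul1.
by move=> k; rewrite !E.
Qed.

End MultiplicativeMaps.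

(** For (1 + t)^a the operator t d/dt log gives a t / (1 + t), so all power sums equal [a]. *)
Lemma newton_rat_binomial (a : rat) : newton (rat_binomial a) (fun=> a).
Proof.
have bS k : rat_binomial a k.+1 *+ k.+1 = (a - k%:R) * rat_binomial a k.
  rewrite /rat_binomial big_ord_recr /= factS natrM invfM [_^-1 * _]mulrC.
  by rewrite -[LHS]mulr_natr !mulrA mulfVK ?Num.Theory.pnatr_eq0 // [_ * (a - _)]mulrC.
split=> [|[|k]]; first by rewrite /rat_binomial big_ord0 divr1.
  by rewrite /ps_mul big_ord1 mul0r.
rewrite /ps_mul big_ord_recl mul0r add0r.
elim: k => [|k IH]; first by rewrite big_ord1 /= bS subr0 mul1r.
(* The summand a binom(a, k+1) is the first term; the rest, -(k+1) binom(a, k+1), is the previous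
   sum, whose signs flip as the index shifts. *)
rewrite big_ord_recl /= expr0 mul1r subn1 bS mulrBl; congr (_ + _).
rewrite mulr_natl IH -sumrN; apply: eq_bigr => i _ /=.
by rewrite /bump /= !add1n exprS mulN1r !mulNr subSS.
Qed.

Lemma newton_binomial (R : comPzRingType) (f : {rmorphism rat -> R}) a (x : R) :
  newton (fun k => f (rat_binomial a k) * x ^+ k) (fun i => f a * x ^+ i).
Proof. exact: newton_scale (newton_rmorph f (newton_rat_binomial a)). Qed.

(** * Adams operations on Z[L] and annihilators *)

Section Translation.
Variable n : nat.
Implicit Types (p q : {mpoly rat[n]}) (w v : 'I_n -> rat).

Definition translate w p : {mpoly rat[n]} := p \mPo [tuple 'X_i + (w i)%:MP | i < n].

HB.instance Definition _ w := GRing.Linear.copy (translate w)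
  (comp_mpoly [tuple 'X_i + (w i)%:MP | i < n]).
HB.instance Definition _ w := GRing.RMorphism.copy (translate w)
  (comp_mpoly [tuple 'X_i + (w i)%:MP | i < n]).

Lemma meval_translate w p v : (translate w p).@[v] = p.@[fun i => v i + w i].
Proof.
rewrite /translate comp_mpoly_meval; apply: meval_eq => i.
by rewrite tnth_mktuple mevalD mevalXU mevalC.
Qed.

(** By linearity and the Leibniz rule it suffices to check the variables. *)
Lemma mderiv_translate w i p : (translate w p)^`M(i) = translate w p^`M(i).
Proof.
pose Q p := (translate w p)^`M(i) = translate w p^`M(i).
have Q1 : Q 1 by rewrite /Q rmorph1 -mpolyC1 !mderivC raddf0.
have QM p1 p2 : Q p1 -> Q p2 -> Q (p1 * p2).
  by rewrite /Q => h1 h2; rewrite rmorphM !mderivM h1 h2 rmorphD !rmorphM.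
have QX j : Q 'X_j.
  rewrite /Q /translate comp_mpolyXU -tnth_nth tnth_mktuple mderivD mderivC addr0.
  rewrite mderivX linearZ /= mnm1E; case: eqP => [<-|_]; last by rewrite !scale0r.
  have -> : (U_(j) - U_(j) = 0 :> 'X_{1..n})%MM.
    by apply/mnmP => l; rewrite mnmBE mnm0E subnn.
  by rewrite mpolyX0 -/(translate w 1) (rmorph1 (translate w)).
rewrite -/(Q p) [p]mpolyE; apply: (big_ind Q) => [|p1 p2 h1 h2|m _].
- by rewrite /Q !raddf0.
- by rewrite /Q !raddfD /= h1 h2.
suff : Q 'X_[m] by rewrite /Q => h; rewrite linearZ !mderivZ linearZ /= h.
rewrite mpolyXE_id; apply: (big_ind Q) => // j _.
by elim: (m j) => // k IH; rewrite exprS; exact: QM.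
Qed.

Lemma mderivm_translate w m p : (translate w p)^`M[m] = translate w p^`M[m].
Proof.
rewrite !mderivm_foldr; elim: flatten => //= i s ->; exact: mderiv_translate.
Qed.

Lemma meval_dhomog d p c v : p \is d.-homog ->
  p.@[fun i => c * v i] = c ^+ d * p.@[v].
Proof.
move=> /dhomogP hp; rewrite !mevalE mulr_sumr big_seq [RHS]big_seq.
apply: eq_bigr => m /hp /= <-; rewrite mulrCA; congr (_ * _).
rewrite mdegE -prodrXr -big_split; apply: eq_bigr => i _.
by rewrite /= exprMn.
Qed.

End Translation.

(** * Shift operators on polynomials *)

Section ShiftPolynomials.
Variable L : zlatticeType.
Implicit Types (p q : P L) (S : Sh L) (u x : L).

Definition ratcoord u : 'I_(rank L) -> rat := fun i => (Defs.coord u 0 i)%:~R.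

(* The action of Z[L] on polynomials, as opposed to polynomial functions. *)
Definition sh_poly S p : P L :=
  \sum_(u <- dom S) translate (ratcoord u) p *~ coeff u S.

Lemma meval_sh_poly S p v : (sh_poly S p).@[v] =
  \sum_(u <- dom S) p.@[fun i => v i + ratcoord u i] *~ coeff u S.
Proof.
rewrite /sh_poly raddf_sum; apply: eq_bigr => u _.
by rewrite raddfMz /= meval_translate.
Qed.

Lemma peval_sh_poly S p x : peval (sh_poly S p) x = sh_act S (peval p) x.
Proof.
rewrite /peval meval_sh_poly; apply: eq_bigr => u _; congr (_ *~ _).
by apply: meval_eq => i; rewrite raddfD mxE intrD.
Qed.

(** By [peval_inj]. The polynomial identity can be differentiated and evaluated at rational points
    outside the lattice. *)
Lemma sh_annP S p : (S \in sh_ann (peval p)) <-> sh_poly S p = 0.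
Proof.
split=> [/asboolP h|h].
  by apply: peval_inj => x; rewrite peval_sh_poly h /peval meval0.
by apply/asboolP => x; rewrite -peval_sh_poly h /peval meval0.
Qed.

Lemma sh_poly_diff S D p : sh_poly S (diff_act D p) = diff_act D (sh_poly S p).
Proof.
rewrite /sh_poly raddf_sum; apply: eq_bigr => u _; rewrite raddfMz; congr (_ *~ _).
rewrite /diff_act raddf_sum; apply: eq_bigr => m _.
by rewrite raddfMz /= mderivm_translate.
Qed.

Lemma sh_polyZ S c p : sh_poly S (c *: p) = c *: sh_poly S p.
Proof.
rewrite /sh_poly scaler_sumr; apply: eq_bigr => u _.
by rewrite linearZ /= scalerMzr.
Qed.

Definition adams k : Sh L -> Sh L := fglift (fun u => shT (u *+ k)).

HB.instance Definition _ k := GRing.Additive.copy (adams k)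
  (fglift (fun u => shT (u *+ k))).

Lemma adamsT k u : adams k (shT u) = shT (u *+ k).
Proof. exact: fgliftT. Qed.

Lemma adams_monoid_morphism k : monoid_morphism (adams k).
Proof.
split=> [|S S']; first by rewrite -shT0 adamsT mul0rn.
elim/sh_ind: S => [|u|S1 S2 h1 h2]; first by rewrite !(raddf0, mul0r).
  elim/sh_ind: S' => [|v|S1 S2 h1 h2]; first by rewrite !(raddf0, mulr0).
    by rewrite -shTD !adamsT -shTD mulrnDl.
  by rewrite mulrBr !raddfB /= h1 h2 mulrBr.
by rewrite mulrBl !raddfB /= h1 h2 mulrBl.
Qed.

HB.instance Definition _ k := GRing.isMonoidMorphism.Build (Sh L) (Sh L) (adams k)
  (adams_monoid_morphism k).

Lemma adams_act k S (h : L -> rat) x :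
  sh_act (adams k S) h x = \sum_(u <- dom S) h (x + u *+ k) *~ coeff u S.
Proof.
rewrite sh_actE -{1}[S]freeg_sumE (raddf_sum (adams k)) raddf_sum.
apply: eq_bigr => u _ /=.
have -> : << coeff u S *g u >> = shT u *~ coeff u S by rewrite /shT freegU_mulz intz.
by rewrite !raddfMz /= adamsT fgliftT.
Qed.

Lemma adams_ann_homog k d S p : (0 < k)%N -> p \is d.-homog ->
  S \in sh_ann (peval p) -> adams k S \in sh_ann (peval p).
Proof.
move=> k0 hp /sh_annP h; apply/asboolP => x; rewrite adams_act.
have kn : k%:R != 0 :> rat by rewrite Num.Theory.pnatr_eq0 -lt0n.
(* Evaluation at x / k, scaled by k^d: homogeneity turns k^d p(x / k + u) into p(x + k u). *)
have := congr1 (fun q => k%:R ^+ d * q.@[fun i => k%:R^-1 * ratcoord x i]) h.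
rewrite /= meval_sh_poly meval0 mulr0 mulr_sumr => H; rewrite -[RHS]H.
apply: eq_bigr => u _; rewrite mulrzAr -(meval_dhomog _ _ hp); congr (_ *~ _).
apply: meval_eq => i; rewrite mulrDr mulVKf // raddfD raddfMn mxE.
by rewrite intrD mulmxnE raddfMn /ratcoord mulr_natl.
Qed.

End ShiftPolynomials.

(** * Annihilators in a Riemann-Roch pair *)

Section RiemannRochAdams.
Variables (L : zlatticeType) (f g : P L).

(** [D] and [D'] are numerators of [td] and of its inverse; the denominators give the scalars. *)
Lemma riemann_roch_diff : riemann_roch_pair f g ->
  exists D D' : Diff L, exists c c' : rat,
    f = c *: diff_act D g /\ g = c' *: diff_act D' f.
Proof.
case=> _ [td [td' [tdE fE]]].
have frac x : exists D m, x = fracQ (quot_class _ D : A g) m.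
  by exists (quot_repr (numQ x)), (denQ x); rewrite quot_reprK fracQK.
have [D [m tdm]] := frac td; have [D' [m' tdm']] := frac td'.
have fD : f = m.+1%:R^-1 *: diff_act D g by rewrite fE tdm AQ_actE.
exists D, D', m.+1%:R^-1, m'.+1%:R^-1; split=> //.
have {1}-> : g = AQ_act (1 : tensQ (A g)).
  have d1 := diff_actX 0%MM g; rewrite mderivm0m mpolyX0 in d1.
  by rewrite (AQ_actE g 1 0) invr1 scale1r d1.
rewrite -tdE tdm tdm' fracQM -rmorphM AQ_actE mulrC diff_actM fD linearZ scalerA.
by rewrite mdenE natrM invfM mulrC.
Qed.

Lemma adams_ann k S : riemann_roch_pair f g -> (0 < k)%N ->
  S \in sh_ann (peval f) -> adams k S \in sh_ann (peval f).
Proof.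
move=> fg k0 /sh_annP Sf; have [D [D' [c [c' [fE gE]]]]] := riemann_roch_diff fg.
have [[d gd] _] := fg.
have /(adams_ann_homog k0 gd) /sh_annP Sg : S \in sh_ann (peval g).
  by apply/sh_annP; rewrite gE sh_polyZ sh_poly_diff Sf linear0 scaler0.
by apply/sh_annP; rewrite fE sh_polyZ sh_poly_diff Sg linear0 scaler0.
Qed.

End RiemannRochAdams.

(** * Adams operations on K_f and on its rationalization *)

Section QuotientLift.
Variables (R S : comPzRingType) (I : idealClosed R) (h : {rmorphism R -> S}).
Hypothesis hI : forall x, x \in I -> h x = 0.

(** The proof that [h] kills [I] is part of the term, so that the morphism structure can be inferred
    from it. *)
Definition quot_lift of (forall x, x \in I -> h x = 0) :=
  fun q : quot_ring I => h (quot_repr q).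

Lemma quot_liftE x : quot_lift hI (quot_class I x) = h x.
Proof.
apply/eqP; rewrite -subr_eq0 -rmorphB; apply/eqP/hI/quot_classP.
exact: quot_reprK.
Qed.

Lemma quot_lift_zmod_morphism : zmod_morphism (quot_lift hI).
Proof.
move=> p q; rewrite -(quot_reprK p) -(quot_reprK q) -quot_classB.
by rewrite !quot_liftE rmorphB.
Qed.

HB.instance Definition _ := GRing.isZmodMorphism.Build (quot_ring I) S (quot_lift hI)
  quot_lift_zmod_morphism.

Lemma quot_lift_monoid_morphism : monoid_morphism (quot_lift hI).
Proof.
split=> [|p q]; first by rewrite -(rmorph1 (quot_class I)) quot_liftE rmorph1.
rewrite -(quot_reprK p) -(quot_reprK q) -rmorphM !quot_liftE.
exact: rmorphM.
Qed.

HB.instance Definition _ := GRing.isMonoidMorphism.Build (quot_ring I) S (quot_lift hI)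
  quot_lift_monoid_morphism.

End QuotientLift.

(** * Functoriality of the rationalization *)

Section TensQMap.
Variables (R S : comPzRingType) (h : {rmorphism R -> S}).

Definition tensQ_map (x : tensQ R) : tensQ S := fracQ (h (numQ x)) (denQ x).

Lemma tensQ_mapE r m : tensQ_map (fracQ r m) = fracQ (h r) m.
Proof.
have /fracQP[k hk] := fracQK (fracQ r m).
by apply/fracQP; exists k; rewrite -!(raddfMn h) hk.
Qed.

Lemma tensQ_map_zmod_morphism : zmod_morphism tensQ_map.
Proof.
have D : {morph tensQ_map : x y / x + y}.
  elim/tensQ_ind => r m; elim/tensQ_ind => s n.
  by rewrite fracQD !tensQ_mapE fracQD raddfD !raddfMn.
by move=> x y; apply: (addIr (tensQ_map y)); rewrite -D !subrK.
Qed.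

HB.instance Definition _ := GRing.isZmodMorphism.Build (tensQ R) (tensQ S) tensQ_map
  tensQ_map_zmod_morphism.

Lemma tensQ_map_monoid_morphism : monoid_morphism tensQ_map.
Proof.
split=> [|x y]; first by rewrite tensQ_mapE rmorph1.
elim/tensQ_ind: x => r m; elim/tensQ_ind: y => s n.
by rewrite fracQM !tensQ_mapE fracQM rmorphM.
Qed.

HB.instance Definition _ := GRing.isMonoidMorphism.Build (tensQ R) (tensQ S) tensQ_map
  tensQ_map_monoid_morphism.

End TensQMap.

Section RatTensQ.
Variable R : comPzRingType.

Lemma ratQ_zmod_morphism : zmod_morphism (@ratQ R).
Proof. by move=> x y; apply: (addIr (ratQ R y)); rewrite -ratQD !subrK. Qed.

HB.instance Definition _ := GRing.isZmodMorphism.Build rat (tensQ R) (@ratQ R)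
  ratQ_zmod_morphism.

Lemma ratQ_monoid_morphism : monoid_morphism (@ratQ R).
Proof. by split; [exact: ratQ1 | exact: ratQM]. Qed.

HB.instance Definition _ := GRing.isMonoidMorphism.Build rat (tensQ R) (@ratQ R)
  ratQ_monoid_morphism.

Lemma fracQ_scale (r : R) m : fracQ r m = (m.+1%:R^-1 : rat) *: inQ r.
Proof. by have := scale_fracQ 1 m r 0; rewrite mul1r mulr1z /mden muln1 => ->. Qed.

Lemma inQ_inj : torsion_free R -> injective (@inQ R).
Proof.
move=> tf x y /fracQP[k]; rewrite mul1n => /eqP.
by rewrite -subr_eq0 -mulrnBl => /eqP /tf /eqP; rewrite subr_eq0 => /eqP.
Qed.

End RatTensQ.

(** * Torsion and additive generators of K_f *)

Section KRing.
Variables (L : zlatticeType) (f : P L).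

(** Functions take values in [rat], so an operator kills [f] as soon as a positive multiple of it
    does. *)
Lemma K_torsion_free : torsion_free (K f).
Proof.
move=> x n; rewrite -(quot_reprK x); set S := quot_repr x.
rewrite -raddfMn -[RHS](raddf0 (quot_class (sh_ann (peval f)))) => /quot_classP.
rewrite subr0 => /asboolP h.
rewrite -[RHS](raddf0 (quot_class (sh_ann (peval f)))); apply/quot_classP.
rewrite subr0; apply/asboolP => y; have := h y.
have -> : sh_act (S *+ n.+1) (peval f) y = sh_act S (peval f) y *+ n.+1.
  elim: n.+1 => [|j IH]; first by rewrite !mulr0n sh_act0.
  rewrite !mulrSr -[X in _ + X]opprK -[- S]sub0r !sh_actB sh_act0 sub0r opprK.
  by rewrite IH.
by move/eqP; rewrite -mulr_natr mulf_eq0 Num.Theory.pnatr_eq0 orbF => /eqP.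
Qed.

Lemma K_ind (Q : K f -> Prop) :
    Q 0 -> (forall u, Q (KT f u)) -> (forall x y, Q x -> Q y -> Q (x - y)) ->
  forall x, Q x.
Proof.
move=> Q0 QT QB x; rewrite -(quot_reprK x).
elim/sh_ind: (quot_repr x) => [|u|a b ha hb]; first by rewrite raddf0.
  exact: QT.
by rewrite raddfB; exact: QB.
Qed.

Lemma tensQ_K_ind (Q : tensQ (K f) -> Prop) :
    Q 0 -> (forall a u, Q (a *: inQ (KT f u))) ->
    (forall x y, Q x -> Q y -> Q (x - y)) ->
  forall x, Q x.
Proof.
move=> Q0 QT QB; elim/tensQ_ind => r m; rewrite fracQ_scale.
elim/K_ind: r => [|u|x y hx hy]; first by rewrite (raddf0 (@inQ (K f))) scaler0.
  exact: QT.
by rewrite (raddfB (@inQ (K f))) scalerBr; exact: QB.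
Qed.

Lemma KT_mulrn u k : KT f (u *+ k) = KT f u ^+ k.
Proof.
elim: k => [|k IH]; first by rewrite mulr0n expr0.
by rewrite mulrS exprS -IH /KT shTD rmorphM.
Qed.

End KRing.

Section AdamsOnK.
Variables (L : zlatticeType) (f g : P L) (fg : riemann_roch_pair f g).

Lemma adams_class_ann k S : S \in sh_ann (peval f) ->
  (quot_class (sh_ann (peval f)) \o adams k.+1) S = 0.
Proof.
move=> Sf; rewrite /= -(raddf0 (quot_class (sh_ann (peval f)))).
by apply/quot_classP; rewrite subr0; exact: (adams_ann fg).
Qed.

(** This is psi^(k+1), since [adams_ann] concerns positive exponents. *)
Definition adamsK k : {rmorphism K f -> K f} := quot_lift (@adams_class_ann k).

Lemma adamsKT k u : adamsK k (KT f u) = KT f (u *+ k.+1).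
Proof. by rewrite [LHS]quot_liftE /= adamsT. Qed.

(** For positive [k] this is psi^k; at 0 it is psi^1 by default. *)
Definition adamsQ k : {rmorphism tensQ (K f) -> tensQ (K f)} :=
  tensQ_map (adamsK k.-1).

Lemma adamsQT k a u : (0 < k)%N ->
  adamsQ k (a *: inQ (KT f u)) = a *: inQ (KT f (u *+ k)).
Proof.
elim/ratP_nat: a => p m k0; rewrite !scale_fracQ [LHS]tensQ_mapE.
by rewrite (rmorphMz (adamsK _)) adamsKT prednK.
Qed.

Lemma adamsQ1 x : adamsQ 1 x = x.
Proof.
elim/tensQ_K_ind: x => [|a u|x y hx hy]; first exact: raddf0.
  by rewrite adamsQT.
by rewrite rmorphB hx hy.
Qed.

Lemma adamsQM i j x : (0 < i)%N -> (0 < j)%N ->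
  adamsQ i (adamsQ j x) = adamsQ (i * j) x.
Proof.
move=> i0 j0; elim/tensQ_K_ind: x => [|a u|x y hx hy]; first by rewrite !rmorph0.
  by rewrite !adamsQT ?muln_gt0 ?i0 // -mulrnA mulnC.
by rewrite !rmorphB hx hy.
Qed.

End AdamsOnK.

(** * Existence and uniqueness of the lambda-operators *)

Theorem theorem3p24 (L : zlatticeType) (f g : P L) :
  riemann_roch_pair f g ->
  exists lam : K f -> pseries (K f),
    [/\ is_lambda_operator lam,
        forall lam', is_lambda_operator lam' -> forall x, lam' x =1 lam x,
        lambda_ring lam &
        exists lamQ : tensQ (K f) -> pseries (tensQ (K f)),
          [/\ is_rational_lambda_operator lamQ,
              forall lamQ', is_rational_lambda_operator lamQ' ->
                forall x, lamQ' x =1 lamQ x,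
              forall (x : K f) (k : nat), lamQ (inQ x) k = inQ (lam x k) &
              lambda_ring lamQ]].
Proof.
move=> fg.
pose ratK : {rmorphism rat -> tensQ (K f)} := @ratQ (K f).
pose inK : {rmorphism K f -> tensQ (K f)} := @inQ (K f).
have inI : injective inK by apply: inQ_inj; exact: K_torsion_free.
have /choice[lamQ lamQP] : forall x : tensQ (K f), exists a,
    newton a (fun i => adamsQ fg i x).
  by move=> x; apply: newton_ex; exact: rat_divisible ratK.
have lamQM := adams_lam_multiplicative ratK lamQP.
have lamQT a u k : lamQ (a *: inQ (KT f u)) k =
    rat_binomial a k *: inQ (KT f (u *+ k)).
  rewrite KT_mulrn (rmorphXn inK).
  (* Both series have the power sums a [T^(iu)]. *)
  apply: (newton_unique ratK (lamQP _) (newton_binomial ratK a (inK (KT f u)))).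
  by move=> i i0; rewrite adamsQT // KT_mulrn (rmorphXn inK).
have lamQ_lin u : lamQ (inK (KT f u)) =1 ps_lin (inK (KT f u)).
  apply: (newton_unique ratK (lamQP _) (newton_lin _)) => i i0.
  have := adamsQT fg 1 u i0; rewrite !scale1r KT_mulrn => ->.
  exact: (rmorphXn inK).
have int_lam x : exists a : pseries (K f), forall k, lamQ (inK x) k = inK (a k).
  elim/K_ind: x => [|u|x y [a ha] [b hb]].
  - exists (ps_one _) => k; rewrite raddf0.
    have -> : lamQ 0 k = ps_one _ k.
      by apply: (newton_unique ratK (lamQP 0) (newton_one _)) => i i0; exact: raddf0.
    by rewrite /ps_one; case: eqP; rewrite ?rmorph1 ?rmorph0.
  - exists (ps_lin (KT f u)) => k; rewrite lamQ_lin.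
    by case: k => [|[|k]]; rewrite /ps_lin /= ?nth_nil ?rmorph1 ?rmorph0.
  (* As the series [b] of y has constant term 1, its inverse [c] exists over K_f, and a c is the
     series of x - y. *)
  - have a0 : b 0%N = 1.
      by apply: inI; rewrite -hb (newton0E (lamQP _)) rmorph1.
    have [c bc] := ps_unit_ex_inv a0.
    exists (ps_mul a c) => k.
    have E : lamQ (inK (x - y)) =1 ps_mul (inK \o a) (inK \o c).
      apply: (ps_unitI (proj1 lamQM (inK y))) => j.
      rewrite -(proj2 lamQM) -raddfD subrK.
      rewrite -ps_mulA (eq_ps_mul (a' := inK \o a) (b' := ps_one _)) // => [|i].
        by rewrite ps_mulC ps_mul1 /= ha.
      rewrite ps_mulC (eq_ps_mul (a' := inK \o b) (b' := inK \o c)) //.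
      have -> : ps_mul (inK \o b) (inK \o c) i = inK (ps_mul b c i).
        by rewrite /ps_mul raddf_sum; apply: eq_bigr => m _; rewrite /= rmorphM.
      by rewrite bc /ps_one; case: eqP; rewrite ?rmorph1 ?rmorph0.
    by rewrite E /ps_mul raddf_sum; apply: eq_bigr => m _; rewrite /= rmorphM.
have /choice[lam lamP] := int_lam.
have lamQ_ring := adams_lambda_ring ratK (adamsQ1 fg) (adamsQM fg) lamQP.
have lam_ring : lambda_ring lam.
  by apply: (sub_lambda_ring inI) lamQ_ring => x k; rewrite lamP.
have lamM : ps_multiplicative lam.
  split=> [x|x y k]; last exact: lambdaD lam_ring k x y.
  by apply: ps_unit_ex_inv; exact: lambda0 lam_ring x.
have lamT u : lam (KT f u) =1 ps_lin (KT f u).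
  move=> k; apply: inI; rewrite -lamP lamQ_lin.
  by case: k => [|[|k]]; rewrite /ps_lin /= ?nth_nil ?rmorph1 ?rmorph0.
exists lam; split=> //.
  (* The two maps agree on a subgroup that contains the generators [T^u]; likewise below with the a
     [T^u]. *)
  move=> lam' [lamM' lamT']; elim/K_ind => [|u|x y hx hy].
  - exact: ps_multiplicative_eq0.
  - by move=> k; rewrite lamT lamT'.
  - exact: ps_multiplicative_eqB.
exists lamQ; split=> //.
move=> lamQ' [lamQM' lamQT']; elim/tensQ_K_ind => [|a u|x y hx hy].
- exact: ps_multiplicative_eq0.
- by move=> k; rewrite lamQT lamQT'.
- exact: ps_multiplicative_eqB.
Qed.
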